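(* There exists an algorithm that, given a graph $G$ on $n$ vertices together with a tree decomposition of $G$ of width $\mathrm{tw}$ and a positive integer $t$, computes the number of feedback vertex sets of $G$ of size exactly $t$ modulo $2$, in time $\mathcal{O}(3^{\mathrm{tw}} n^c)$ for some constant $c$ independent of $\mathrm{tw}$.
   Context: A feedback vertex set of a graph $G=(V,E)$ is a set $X\subseteq V$ such that $G-X$ is a forest. A tree decomposition of $G$ is a pair $(T,B)$ where $T$ is a tree and $B$ assigns to each node $x$ of $T$ a bag $B(x)\subseteq V$ such that every vertex lies in some bag, every edge has both endpoints in some bag, and for every vertex $v$ the nodes whose bags contain $v$ induce a connected subtree of $T$. Its width is $\max_x |B(x)|-1$. *)

(* Defs.v *)
From mathcomp Require Import all_boot boolp.

Set Implicit Arguments.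
Unset Strict Implicit.
Unset Printing Implicit Defensive.

(* Graphs are relations on a finite type. *)

Definition simple_graph (V : finType) (e : rel V) : Prop :=
  symmetric e /\ irreflexive e.

Definition induced (V : finType) (e : rel V) (A : {set V}) :
  rel {x : V | x \in A} := fun u v => e (val u) (val v).
Arguments induced {V} e A.

Definition connected (V : finType) (e : rel V) : Prop :=
  forall x y : V, connect e x y.

(* In a simple graph, a [ucycle] with at least three vertices is a cycle in the
   sense of graph theory; those of size 2 merely walk an edge back and forth. *)
Definition forest (V : finType) (e : rel V) : Prop :=
  simple_graph e /\ forall s : seq V, ucycle e s -> size s <= 2.

Definition tree (V : finType) (e : rel V) : Prop :=
  [/\ 0 < #|V|, forest e & connected e].

Definition feedback_vertex_set (V : finType) (e : rel V) (X : {set V}) : Prop :=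
  forest (induced e (~: X)).

Definition fvs_of_size (V : finType) (e : rel V) (t : nat) : {set {set V}} :=
  [set X : {set V} | `[< feedback_vertex_set e X >] & #|X| == t].

(* The nodes of a tree decomposition whose bags contain a given vertex span a
   connected subgraph of the tree T, which is a nonempty subtree because of the
   first clause. *)
Definition tree_decomposition (V W : finType) (e : rel V) (T : rel W)
    (B : W -> {set V}) : Prop :=
  tree T /\
  [/\ forall v : V, exists x : W, v \in B x,
      forall u v : V, e u v -> exists x : W, (u \in B x) && (v \in B x)
    & forall v : V, connected (induced T [set x | v \in B x])].

(* Truncated predecessor: the width is 0 instead of -1 if all bags are empty,
   which is only possible for the graph without vertices. *)
Definition width (V W : finType) (B : W -> {set V}) : nat :=
  (\max_(x : W) #|B x|).-1.

(* Random access machine with logarithmic cost: registers and memory cells hold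
   arbitrary natural numbers, and an operation is charged for the number of
   binary digits of its operands, results and addresses (for products and
   quotients, the schoolbook cost).  Programs are structured instead of using
   jumps. *)

Definition bitlen (a : nat) : nat := (trunc_log 2 a).+1.

Inductive expr : Type :=
  | Const of nat
  | Reg of nat
  | Mem of expr
  | Add of expr & expr
  | Sub of expr & expr
  | Mul of expr & expr
  | Div of expr & expr.

Inductive cmd : Type :=
  | Skip
  | Assign of nat & expr
  | Store of expr & expr
  | Seq of cmd & cmd
  | If of expr & cmd & cmd
  | While of expr & cmd.

Record state : Type := State { regs : nat -> nat; mem : nat -> nat }.

Definition upd (f : nat -> nat) (i v : nat) : nat -> nat :=
  fun j => if j == i then v else f j.

(* Subtraction is truncated, and division by 0 yields 0. *)
Fixpoint eval (s : state) (a : expr) : nat :=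
  match a with
  | Const k => k
  | Reg i => regs s i
  | Mem a1 => mem s (eval s a1)
  | Add a1 a2 => eval s a1 + eval s a2
  | Sub a1 a2 => eval s a1 - eval s a2
  | Mul a1 a2 => eval s a1 * eval s a2
  | Div a1 a2 => eval s a1 %/ eval s a2
  end.

Fixpoint ecost (s : state) (a : expr) : nat :=
  match a with
  | Const k => bitlen k
  | Reg i => bitlen i + bitlen (regs s i)
  | Mem a1 => ecost s a1 + bitlen (eval s a1) + bitlen (mem s (eval s a1))
  | Add a1 a2 | Sub a1 a2 =>
      ecost s a1 + ecost s a2 + bitlen (eval s a1) + bitlen (eval s a2)
  | Mul a1 a2 | Div a1 a2 =>
      ecost s a1 + ecost s a2 + bitlen (eval s a1) * bitlen (eval s a2)
  end.

(* [exec p s s' k]: started in [s], the program [p] halts in [s'] at cost [k].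
   Guards are true when nonzero. *)
Inductive exec : cmd -> state -> state -> nat -> Prop :=
  | exec_skip s : exec Skip s s 1
  | exec_assign s i a :
      exec (Assign i a) s (State (upd (regs s) i (eval s a)) (mem s))
        (1 + ecost s a + bitlen i + bitlen (eval s a))
  | exec_store s a b :
      exec (Store a b) s (State (regs s) (upd (mem s) (eval s a) (eval s b)))
        (1 + ecost s a + ecost s b + bitlen (eval s a) + bitlen (eval s b))
  | exec_seq p q s s1 s2 k1 k2 :
      exec p s s1 k1 -> exec q s1 s2 k2 -> exec (Seq p q) s s2 (k1 + k2)
  | exec_if a p q s s1 k :
      exec (if eval s a != 0 then p else q) s s1 k ->
      exec (If a p q) s s1 (1 + ecost s a + k)
  | exec_while_false a p s :
      eval s a = 0 -> exec (While a p) s s (1 + ecost s a)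
  | exec_while_true a p s s1 s2 k1 k2 :
      eval s a <> 0 -> exec p s s1 k1 -> exec (While a p) s1 s2 k2 ->
      exec (While a p) s s2 (1 + ecost s a + k1 + k2).

Lemma exec_deterministic p s s1 s2 k1 k2 :
  exec p s s1 k1 -> exec p s s2 k2 -> s1 = s2 /\ k1 = k2.
Proof.
move=> H; elim: H s2 k2 => {p s s1 k1}.
- by move=> s s2 k2 H; inversion H.
- by move=> s i a s2 k2 H; inversion H.
- by move=> s a b s2 k2 H; inversion H.
- move=> p q s s1 s2 k1 k2 _ IHp _ IHq s3 k3 H; inversion H; subst.
  have [? ?] := IHp _ _ H2; subst.
  by have [-> ->] := IHq _ _ H6.
- move=> a p q s s1 k _ IH s2 k2 H; inversion H; subst.
  by have [-> ->] := IH _ _ H6.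
- by move=> a p s a0 s2 k2 H; inversion H.
- move=> a p s s1 s2 k1 k2 a0 _ IHp _ IHw s3 k3 H; inversion H; subst=> //.
  have [? ?] := IHp _ _ H3; subst.
  by have [-> ->] := IHw _ _ H7.
Qed.

Definition init (input : seq nat) : state :=
  State (fun _ => 0) (fun i => nth 0 input i).

(* By determinism, the run below is the only one on this input.
   The result is left in register 0. *)
Definition computes_within (p : cmd) (input : seq nat) (out bound : nat) : Prop :=
  exists (s : state) (k : nat),
    [/\ exec p (init input) s k, regs s 0 = out & k <= bound].

Definition binary (t : nat) : seq nat :=
  [seq t %/ 2 ^ i %% 2 | i <- iota 0 (bitlen t)].

(* The input consists of n, the number N of nodes, the adjacency matrices of
   the graph and of the tree, the incidence matrix between nodes and bag
   elements (all row by row, with entries 0 and 1), and t in binary, least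
   significant digit first and closed by 2.  The number t is not stored in a
   single cell because reading that cell would cost time log t, which is not
   bounded in terms of n when t > n. *)
Definition encode (n N : nat) (G : rel 'I_n) (T : rel 'I_N)
    (B : 'I_N -> {set 'I_n}) (t : nat) : seq nat :=
  [:: n; N]
  ++ [seq nat_of_bool (G u v) | u <- enum 'I_n, v <- enum 'I_n]
  ++ [seq nat_of_bool (T x y) | x <- enum 'I_N, y <- enum 'I_N]
  ++ [seq nat_of_bool (v \in B x) | x <- enum 'I_N, v <- enum 'I_n]
  ++ rcons (binary t) 2.

(* Main.v *)
(* Following Cut & Count, give every vertex a spin 0 (deleted), 1 or 2 (one of two
   sides of a cut).  A deleted vertex weighs 2x, an edge between two remaining
   vertices weighs 2 if their spins agree and 0 otherwise.  The vertex sets X deleted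
   by the spins then contribute
     (2x)^|X| 2^(e(G-X)) 2^(cc(G-X)) = 2^n x^|X| 2^(e(G-X) - |V-X| + cc(G-X)),
   and the last exponent, the cyclomatic number of G-X, vanishes exactly for forests.
   With x a large power of 2, the parity of the coefficient of x^t can be read off
   the binary expansion of the total weight.  The total weight is computed by
   eliminating the vertices along the tree decomposition, whose nodes are ordered so
   that every node but the first has exactly one earlier neighbour: node k sends to
   that neighbour a table of partial sums indexed by the spins of the vertices that
   still occur in earlier bags, which takes 3^|bag| steps.

   The program is written in a language of sums and products whose number of terms
   is syntactically polynomial; such terms need polynomially many bits, so that their
   compilation runs in polynomial time. *)

Require Import Defs.
From mathcomp Require Import all_boot boolp.
From mathcomp Require Import zify.

Set Implicit Arguments.
Unset Strict Implicit.
Unset Printing Implicit Defensive.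

(** * Compiling sums and products to the random access machine *)

(** The term language loops only a small number of times, which keeps every compiled term
    polynomial. The exponential factor enters at one place outside of it: a command loop over the
    3^|bag| spin assignments of a bag. One iteration is cheap because an assignment determines by
    itself the cell of the message to which its product is added; nothing is searched.

    All sums are exact natural numbers. The total must be divided by 2^n before a parity makes
    sense, so reducing modulo 2 along the way would lose the answer. Bit lengths therefore have to
    be controlled; as message cells only grow, a bound on the final messages covers every
    intermediate content.

    Since t may be far larger than n, only n + 2 cells of it are inspected, and the run ends with 0
    if t > n. A bag may have tw + 1 elements; the extra factor 3 goes into the constant. *)

(* Variables are positions in the environment.  [Sum] and [Prod] append their index
   to it, and [Call k a b] evaluates [b] in the environment of the [k] arguments. *)
Inductive tm : Type :=
  | Var of nat
  | Cst of nat
  | Plus of tm & tm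
  | Minus of tm & tm
  | Times of tm & tm
  | Quot of tm & tm
  | Rd of tm
  | Sum of tm & tm
  | Prod of tm & tm
  | Call of nat & (nat -> tm) & tm.

Fixpoint den (r : seq nat) (m : nat -> nat) (t : tm) : nat :=
  match t with
  | Var i => nth 0 r i
  | Cst k => k
  | Plus a b => den r m a + den r m b
  | Minus a b => den r m a - den r m b
  | Times a b => den r m a * den r m b
  | Quot a b => den r m a %/ den r m b
  | Rd a => m (den r m a)
  | Sum c b => \sum_(i < den r m c) den (rcons r i) m b
  | Prod c b => \prod_(i < den r m c) den (rcons r i) m b
  | Call k a b => den (mkseq (fun i => den r m (a i)) k) m b
  end.

(* A small term has a polynomially bounded value, whereas the value of any other
   well-typed term only has polynomially many bits.  The flags [sm] say which
   variables are small; cells 0 and 1 hold the sizes n and N of the input. *)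
Fixpoint small (sm : seq bool) (t : tm) : bool :=
  match t with
  | Var i => nth false sm i
  | Cst _ => true
  | Plus a b | Times a b => small sm a && small sm b
  | Minus a _ | Quot a _ => small sm a
  | Rd (Cst i) => i <= 1
  | Rd _ => false
  | Sum c b => small sm c && small (rcons sm true) b
  | Prod _ _ => false
  | Call k a b => small (mkseq (fun i => small sm (a i)) k) b
  end.

Fixpoint wt (sm : seq bool) (t : tm) : bool :=
  match t with
  | Var i => i < size sm
  | Cst _ => true
  | Plus a b | Minus a b | Times a b | Quot a b => wt sm a && wt sm b
  | Rd a => wt sm a
  | Sum c b | Prod c b => [&& wt sm c, small sm c & wt (rcons sm true) b]
  | Call k a b =>
      all (fun i => wt sm (a i)) (iota 0 k)
      && wt (mkseq (fun i => small sm (a i)) k) b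
  end.

Fixpoint seqs (f : nat -> cmd) (i k : nat) : cmd :=
  if k is k'.+1 then Seq (f i) (seqs f i.+1 k') else Skip.

(** Register [o] holds the number of iterations and [o.+1] the index; the truncated difference is
    nonzero exactly while the index is smaller. *)
Definition loop (o : nat) (body : cmd) : cmd :=
  Seq (Assign o.+1 (Const 0))
    (While (Defs.Sub (Reg o) (Reg o.+1))
      (Seq body (Assign o.+1 (Add (Reg o.+1) (Const 1))))).

Definition comp_op (op : expr -> expr -> expr) (ca cb : cmd) (o : nat) : cmd :=
  Seq ca (Seq cb (Assign o (op (Reg o) (Reg o.+1)))).

(** Registers: [o] the number of iterations, [o.+1] the index, which is the new variable of the
    body, [o.+2] the accumulator, [o.+3] the value of the body. *)
Definition comp_fold (op : expr -> expr -> expr) (k : nat) (cc cb : cmd)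
    (o : nat) : cmd :=
  Seq cc (Seq (Assign o.+2 (Const k))
    (Seq (loop o (Seq cb (Assign o.+2 (op (Reg o.+2) (Reg o.+3)))))
      (Assign o (Reg o.+2)))).

(* [vs] lists the registers of the variables; registers from [o] on are free, and the
   result is left in register [o]. *)
Fixpoint compile (vs : seq nat) (o : nat) (t : tm) : cmd :=
  match t with
  | Var i => Assign o (Reg (nth 0 vs i))
  | Cst k => Assign o (Const k)
  | Plus a b => comp_op Add (compile vs o a) (compile vs o.+1 b) o
  | Minus a b => comp_op Defs.Sub (compile vs o a) (compile vs o.+1 b) o
  | Times a b => comp_op Mul (compile vs o a) (compile vs o.+1 b) o
  | Quot a b => comp_op Div (compile vs o a) (compile vs o.+1 b) o
  | Rd a => Seq (compile vs o a) (Assign o (Defs.Mem (Reg o)))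
  | Sum c b => comp_fold Add 0 (compile vs o c) (compile (rcons vs o.+1) o.+3 b) o
  | Prod c b => comp_fold Mul 1 (compile vs o c) (compile (rcons vs o.+1) o.+3 b) o
  | Call k a b =>
      Seq (seqs (fun i => compile vs (o + i) (a i)) 0 k)
        (Seq (compile (iota o k) (o + k) b) (Assign o (Reg (o + k))))
  end.

(** * Polynomial bounds and binary lengths *)

Definition poly_bounded (f : nat -> nat) : Prop :=
  exists c, forall L, 1 < L -> f L <= L ^ c.

Lemma poly_const k : poly_bounded (fun=> k).
Proof. by exists k => L L1; apply: ltnW; apply: ltn_expl. Qed.

Lemma poly_id : poly_bounded id.
Proof. by exists 1. Qed.

Lemma poly_exp c : poly_bounded (fun L => L ^ c).
Proof. by exists c. Qed.

Lemma poly_mul f g : poly_bounded f -> poly_bounded g -> poly_bounded (fun L => f L * g L).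
Proof.
move=> [a fa] [b gb]; exists (a + b) => L L1.
by rewrite expnD leq_mul ?fa ?gb.
Qed.

Lemma poly_add f g : poly_bounded f -> poly_bounded g -> poly_bounded (fun L => f L + g L).
Proof.
move=> [a fa] [b gb]; exists (maxn a b).+1 => L L1.
have L0 : 0 < L by apply: ltnW.
rewrite expnS; apply: (@leq_trans (2 * L ^ maxn a b)); last by rewrite leq_mul2r L1 orbT.
rewrite mul2n -addnn; apply: leq_add.
  by apply: leq_trans (fa _ L1) _; rewrite leq_pexp2l // leq_maxl.
by apply: leq_trans (gb _ L1) _; rewrite leq_pexp2l // leq_maxr.
Qed.

Ltac poly_tac := repeat first [apply: poly_add | apply: poly_mul | apply: poly_const | apply: poly_exp | apply: poly_id].

Lemma bitlen_gt0 a : 0 < bitlen a. Proof. by []. Qed.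

Lemma bitlenP a L : 0 < L -> (bitlen a <= L) = (a < 2 ^ L).
Proof.
move=> L0; rewrite /bitlen; case: a => [|a]; first by rewrite trunc_log0 L0 expn_gt0.
apply/idP/idP => H.
  by apply: (leq_trans (@trunc_log_ltn 2 a.+1 isT)); rewrite leq_exp2l.
rewrite -(@ltn_exp2l 2) //; apply: leq_ltn_trans H; exact: trunc_logP.
Qed.

Lemma bitlen_lt a : a < 2 ^ bitlen a.
Proof. by rewrite -bitlenP. Qed.

Lemma bitlen_le a b : a <= b -> bitlen a <= bitlen b.
Proof. by move=> ab; rewrite bitlenP // (leq_ltn_trans ab) ?bitlen_lt. Qed.

Lemma bitlen_leS a : bitlen a <= a.+1.
Proof. by rewrite bitlenP // (ltn_trans (ltnSn a)) // ltn_expl. Qed.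

Lemma bitlen_le_pos a L : 0 < L -> a <= L -> bitlen a <= L.
Proof. by move=> L0 aL; rewrite bitlenP // (leq_ltn_trans aL) // ltn_expl. Qed.

Lemma bitlenD a b : bitlen (a + b) <= bitlen a + bitlen b.
Proof.
rewrite bitlenP ?addn_gt0 //; have := bitlen_lt a; have := bitlen_lt b.
rewrite expnD.
have: 1 < 2 ^ bitlen a by rewrite (@leq_exp2l 2 1).
have: 1 < 2 ^ bitlen b by rewrite (@leq_exp2l 2 1).
nia.
Qed.

Lemma bitlenM a b : bitlen (a * b) <= bitlen a + bitlen b.
Proof. by rewrite bitlenP ?addn_gt0 // expnD ltn_mul ?bitlen_lt. Qed.

(** Each further summand costs at most one more bit. This is crude, but harmless for small [c]. *)
Lemma bitlen_sum c F L : 0 < L -> (forall i, i < c -> bitlen (F i) <= L) ->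
  bitlen (\sum_(i < c) F i) <= c + L.
Proof.
move=> L0; elim: c => [|c IH] H; first by rewrite big_ord0.
rewrite big_ord_recr /=.
have /IH : forall i, i < c -> bitlen (F i) <= L by move=> i ic; apply: H; apply: ltnW.
have := H c (ltnSn c).
rewrite !bitlenP ?addn_gt0 ?L0 ?orbT // addSn expnS.
have: 2 ^ L <= 2 ^ (c + L) by rewrite leq_exp2l ?leq_addl.
move: (2 ^ L) (2 ^ (c + L)) (\sum_(i < c) F i) => x y z; lia.
Qed.

Lemma bitlen_prod c F L : 0 < L -> (forall i, i < c -> bitlen (F i) <= L) ->
  bitlen (\prod_(i < c) F i) <= (c * L).+1.
Proof.
move=> L0; elim: c => [|c IH] H; first by rewrite big_ord0.
rewrite big_ord_recr /= mulSn addnC -addSn.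
apply: leq_trans (bitlenM _ _) _; apply: leq_add; last by apply: H.
by apply: IH => i ic; apply: H; apply: ltnW.
Qed.

(** * Size of the values of well-typed terms *)

(** One parameter bounds the bit lengths of all values and the small values themselves, so that one
    polynomial in [L] controls both iteration counts and the cost of operations. *)
Definition env_ok (L : nat) (sm : seq bool) (r : seq nat) : Prop :=
  forall i, bitlen (nth 0 r i) <= L /\ (nth false sm i -> nth 0 r i <= L).

Definition mem_ok (L : nat) (m : nat -> nat) : Prop :=
  [/\ forall a, bitlen (m a) <= L, m 0 <= L & m 1 <= L].

Lemma env_ok_leq L L' sm r : L <= L' -> env_ok L sm r -> env_ok L' sm r.
Proof.
move=> LL H i; have [H1 H2] := H i; split; first exact: leq_trans LL.
by move=> /H2 /leq_trans; apply.
Qed.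

Lemma mem_ok_leq L L' m : L <= L' -> mem_ok L m -> mem_ok L' m.
Proof.
move=> LL [H1 H2 H3]; split; [move=> a|..]; exact: leq_trans LL.
Qed.

Lemma env_ok_rcons L sm r (b : bool) v : size r = size sm -> env_ok L sm r ->
  bitlen v <= L -> (b -> v <= L) -> env_ok L (rcons sm b) (rcons r v).
Proof.
move=> sz H vL bL i; rewrite !nth_rcons sz.
by case: ltngtP => // _; split=> //; apply: leq_trans vL.
Qed.

Lemma env_ok_mkseq L k f (g : nat -> bool) : 0 < L ->
  (forall i, i < k -> bitlen (f i) <= L /\ (g i -> f i <= L)) ->
  env_ok L (mkseq g k) (mkseq f k).
Proof.
move=> L0 H i; have [ik|ki] := ltnP i k; first by rewrite !nth_mkseq //; apply: H.
by rewrite !nth_default ?size_mkseq ?bitlen_le_pos.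
Qed.

Lemma leq_exp_self L c : 1 < L -> L <= L ^ c.+1.
Proof. by move=> L1; rewrite expnS leq_pmulr // expn_gt0 ltnW. Qed.

(** Provides a common exponent for the arguments of a [Call]. *)
Lemma bounded_choice (P : nat -> nat -> Prop) k :
  (forall i c c', c <= c' -> P i c -> P i c') ->
  (forall i, i < k -> exists c, P i c) -> exists c, forall i, i < k -> P i c.
Proof.
move=> mono; elim: k => [|k IH] H; first by exists 0.
have [|c Hc] := IH; first by move=> i ik; apply: H; apply: ltnW.
have [c' Hc'] := H k (ltnSn k).
exists (maxn c c') => i; rewrite ltnS leq_eqVlt => /orP[/eqP->|ik].
  by apply: mono Hc'; rewrite leq_maxr.
by apply: mono (Hc _ ik); rewrite leq_maxl.
Qed.

Definition den_bounded (sm : seq bool) (t : tm) (c : nat) : Prop :=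
  forall L r m, 1 < L -> size r = size sm -> env_ok L sm r -> mem_ok L m ->
    bitlen (den r m t) <= L ^ c /\ (small sm t -> den r m t <= L ^ c).

Lemma den_bounded_leq sm t c c' : c <= c' -> den_bounded sm t c ->
  den_bounded sm t c'.
Proof.
move=> cc H L r m L1 sz er mr; have [H1 H2] := H L r m L1 sz er mr.
have e : L ^ c <= L ^ c' by rewrite leq_pexp2l // ltnW.
by split=> [|/H2 H3]; apply: leq_trans e.
Qed.

(** The index may exceed [L], so the body is bounded with parameter [L ^ dc.+1]. The successor keeps
    this parameter at least [L] even if [dc] is 0. *)
Lemma body_bounded sm c b dc db : small sm c ->
  den_bounded sm c dc -> den_bounded (rcons sm true) b db ->
  forall L r m i, 1 < L -> size r = size sm -> env_ok L sm r -> mem_ok L m ->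
  i < den r m c ->
  bitlen (den (rcons r i) m b) <= (L ^ dc.+1) ^ db
  /\ (small (rcons sm true) b -> den (rcons r i) m b <= (L ^ dc.+1) ^ db).
Proof.
move=> sc Dc Db L r m i L1 sz er mr ic; have [_ /(_ sc) C] := Dc L r m L1 sz er mr.
have LL := leq_exp_self dc L1.
have L1' : 1 < L ^ dc.+1 := leq_trans L1 LL.
have iL : i <= L ^ dc.+1.
  by apply: leq_trans (ltnW ic) (leq_trans C _); rewrite leq_pexp2l // ltnW.
apply: Db => //; first by rewrite !size_rcons sz.
  by apply: env_ok_rcons => //; [exact: env_ok_leq er | rewrite bitlen_le_pos // ltnW].
exact: mem_ok_leq mr.
Qed.

(** Small iteration counts make the induction work: a product of [L ^ c1] factors is exponential in
    value but has polynomially many bits, and nested binders merely compose polynomials. *)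
Lemma den_bound t sm : wt sm t -> exists c, den_bounded sm t c.
Proof.
elim: t sm => [i|k|a IHa b IHb|a IHa b IHb|a IHa b IHb|a IHa b IHb|a IHa|a IHa b IHb|a IHa b IHb|k a IHa b IHb] sm /=.
- by move=> _; exists 1 => L r m L1 sz er _ /=; rewrite expn1.
- move=> _; have [c Hc] : poly_bounded (fun=> k.+1) by poly_tac.
  exists c => L r m L1 _ _ _ /=; have := Hc _ L1.
  split; first exact: leq_trans (bitlen_leS _) _.
  by move=> _; apply: ltnW.
- case/andP=> /IHa[c1 H1] /IHb[c2 H2].
  have [c Hc] : poly_bounded (fun L => L ^ c1 + L ^ c2) by poly_tac.
  exists c => L r m L1 sz er mr /=; have [A1 A2] := H1 L r m L1 sz er mr;
    have [B1 B2] := H2 L r m L1 sz er mr.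
  split; first by apply: leq_trans (bitlenD _ _) (leq_trans _ (Hc _ L1)); apply: leq_add.
  by case/andP=> /A2 A3 /B2 B3; apply: leq_trans (Hc _ L1); apply: leq_add.
- case/andP=> /IHa[c1 H1] _; exists c1 => L r m L1 sz er mr /=.
  have [A1 A2] := H1 L r m L1 sz er mr; split; first by apply: leq_trans A1;
    rewrite bitlen_le ?leq_subr.
  by move=> /A2 A3; apply: leq_trans A3; rewrite leq_subr.
- case/andP=> /IHa[c1 H1] /IHb[c2 H2].
  have [c Hc] : poly_bounded (fun L => L ^ c1 + L ^ c2 + L ^ c1 * L ^ c2) by poly_tac.
  exists c => L r m L1 sz er mr /=; have [A1 A2] := H1 L r m L1 sz er mr;
    have [B1 B2] := H2 L r m L1 sz er mr.
  split; first by apply: leq_trans (bitlenM _ _) (leq_trans _ (Hc _ L1));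
    apply: leq_trans (leq_addr _ _); apply: leq_add.
  case/andP=> /A2 A3 /B2 B3; apply: leq_trans (Hc _ L1); apply: leq_trans (leq_addl _ _);
    exact: leq_mul.
- case/andP=> /IHa[c1 H1] _; exists c1 => L r m L1 sz er mr /=.
  have [A1 A2] := H1 L r m L1 sz er mr; split; first by apply: leq_trans A1;
    rewrite bitlen_le ?leq_div.
  by move=> /A2 A3; apply: leq_trans A3; rewrite leq_div.
- move=> _; exists 1 => L r m L1 sz er [m1 m2 m3] /=; rewrite expn1; split=> //.
  by case: (a) => //= -[|[|i]].
- case/and3P=> /IHa[c1 H1] sa /IHb[c2 H2].
  have [c Hc] : poly_bounded (fun L => L ^ c1 + (L ^ c1.+1) ^ c2 + L ^ c1 * (L ^ c1.+1) ^ c2).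
    by do ?apply: poly_add; do ?apply: poly_mul; do ?apply: poly_exp;
      exists (c1.+1 * c2) => L _; rewrite expnM.
  exists c => L r m L1 sz er mr /=; have [A1 /(_ sa) A2] := H1 L r m L1 sz er mr.
  have L1' : 1 < L ^ c1.+1 by rewrite (leq_trans L1) ?leq_exp_self.
  have B i : i < den r m a -> _ := body_bounded (i := i) sa H1 H2 L1 sz er mr.
  have L0 : 0 < (L ^ c1.+1) ^ c2 by rewrite expn_gt0 ltnW.
  split.
    apply: leq_trans (Hc _ L1); apply: leq_trans (leq_addr _ _).
    apply: leq_trans (bitlen_sum (F := fun i => den (rcons r i) m b) L0 _) _;
      first by move=> i /B[].
    by rewrite leq_add2r.
  case/andP=> _ sb; apply: leq_trans (Hc _ L1); apply: leq_trans (leq_addl _ _).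
  apply: (@leq_trans (\sum_(i < den r m a) (L ^ c1.+1) ^ c2)).
    by apply: leq_sum => i _; apply (B i (ltn_ord i)).
  by rewrite sum_nat_const card_ord leq_mul2r A2 orbT.
- case/and3P=> /IHa[c1 H1] sa /IHb[c2 H2].
  have [c Hc] : poly_bounded (fun L => L ^ c1 * (L ^ c1.+1) ^ c2 + 1).
    by do ?apply: poly_add; do ?apply: poly_mul; do ?apply: poly_exp;
      [exists (c1.+1 * c2) => L _; rewrite expnM|apply: poly_const].
  exists c => L r m L1 sz er mr /=; have [A1 /(_ sa) A2] := H1 L r m L1 sz er mr.
  have L1' : 1 < L ^ c1.+1 by rewrite (leq_trans L1) ?leq_exp_self.
  have B i : i < den r m a -> _ := body_bounded (i := i) sa H1 H2 L1 sz er mr.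
  have L0 : 0 < (L ^ c1.+1) ^ c2 by rewrite expn_gt0 ltnW.
  split=> //.
  apply: leq_trans (Hc _ L1); rewrite addn1.
  apply: leq_trans (bitlen_prod (F := fun i => den (rcons r i) m b) L0 _) _;
    first by move=> i /B[].
  by rewrite ltnS leq_mul2r A2 orbT.
- case/andP=> wa /IHb[c2 H2].
  have [c1 H1] : exists c1, forall i, i < k -> den_bounded sm (a i) c1.
    apply: bounded_choice; first by move=> *; apply: den_bounded_leq; eassumption.
    move=> i ik; apply: IHa; apply: (allP wa); by rewrite mem_iota.
  exists (c1.+1 * c2) => L r m L1 sz er mr /=; rewrite expnM.
  have L1' : 1 < L ^ c1.+1 by rewrite (leq_trans L1) ?leq_exp_self.
  apply: H2 => //; first by rewrite !size_mkseq.
    apply: env_ok_mkseq => [|i ik]; first exact: ltnW.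
    by apply: (den_bounded_leq (leqnSn c1) (H1 _ ik)).
  by apply: mem_ok_leq mr; apply: leq_exp_self.
Qed.

(** * Correctness and cost of compiled terms *)

Definition set_reg (i v : nat) (s : state) : state :=
  State (upd (regs s) i v) (Defs.mem s).

Lemma upd_eq f i v : upd f i v i = v.
Proof. by rewrite /upd eqxx. Qed.

Lemma upd_neq f i v j : j != i -> upd f i v j = f j.
Proof. by rewrite /upd => /negbTE->. Qed.

(** The invariant must survive a change of the index register, which the loop resets and increments
    outside of [body]. The factor [cnt.+1] leaves room for the failing test; 20 is generous for
    guard, reset and increment. *)
Lemma exec_loop o body (I : nat -> state -> Prop) cnt K :
  (forall i v s, I i s -> I i (set_reg o.+1 v s)) ->
  (forall i s, i < cnt -> regs s o = cnt -> regs s o.+1 = i -> I i s ->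
    exists s' k, [/\ exec body s s' k, regs s' o = cnt, regs s' o.+1 = i,
      I i.+1 s' & k <= K]) ->
  forall s, regs s o = cnt -> I 0 s ->
  exists s' k, [/\ exec (loop o body) s s' k, I cnt s' &
    k <= cnt.+1 * (K + 20 * (bitlen o.+1 + bitlen cnt))].
Proof.
move=> Iset Ibody s0 s0o I0; rewrite /loop.
set w := While _ _; set B := bitlen o.+1 + bitlen cnt.
have Bo : bitlen o <= bitlen o.+1 by apply: bitlen_le.
suff H : forall d i s, i + d = cnt -> regs s o = cnt -> regs s o.+1 = i -> I i s ->
    exists s' k, [/\ exec w s s' k, I cnt s' & k <= d * (K + 20 * B) + 7 * B].
  have s1o : regs (set_reg o.+1 0 s0) o = cnt by rewrite /= upd_neq // neq_ltn ltnSn.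
  have [s' [k [H1 H2 H3]]] := H cnt 0 _ erefl s1o (upd_eq _ _ _) (Iset _ _ _ I0).
  exists s', (1 + 1 + bitlen o.+1 + 1 + k); split=> //; first by apply: exec_seq H1;
    apply: (exec_assign _ _ (Const 0)).
  rewrite mulSn; move: H3; have := bitlen_gt0 o.+1.
  have: bitlen o.+1 <= B by apply: leq_addr.
  rewrite -/B; clear H; clearbody B; lia.
elim=> [|d IH] i s.
  rewrite addn0 => -> so si Ii; exists s, (1 + ecost s (Defs.Sub (Reg o) (Reg o.+1)));
    split=> //.
    by apply: exec_while_false; rewrite /= so si subnn.
  rewrite /= so si /B; move: (bitlen_gt0 o.+1) (bitlen_gt0 o) Bo; lia.
move=> id so si Ii; have ic : i < cnt by lia.
have [s1 [k1 [e1 o1 i1 I1 K1]]] := Ibody i s ic so si Ii.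
have so2 : regs (set_reg o.+1 i.+1 s1) o = cnt by rewrite /= upd_neq // neq_ltn ltnSn.
have idS : i.+1 + d = cnt by rewrite addSnnS.
have [s2 [k2 [e2 I2 K2]]] :=
  IH i.+1 (set_reg o.+1 i.+1 s1) idS so2 (upd_eq _ _ _) (Iset _ _ _ I1).
have bi : bitlen i <= bitlen cnt by apply/bitlen_le/ltnW.
have biS : bitlen i.+1 <= bitlen cnt by apply/bitlen_le.
exists s2; eexists; split; [|exact: I2|].
  apply: exec_while_true e2; first by rewrite /= so si; lia.
  apply: exec_seq e1 _.
  have -> : set_reg o.+1 i.+1 s1 = State (upd (regs s1) o.+1 (eval s1 (Add (Reg o.+1) (Const 1)))) (Defs.mem s1).
    by rewrite /= i1 addn1.
  exact: exec_assign.
have b1 : bitlen 1 = 1 by [].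
rewrite /= so si i1 addn1 mulSn b1.
have BE : bitlen o.+1 + bitlen cnt = B by [].
have c0 := bitlen_gt0 cnt; have o0 := bitlen_gt0 o.+1.
clear IH; clearbody B; lia.
Qed.
(** The frame condition below [o] protects the variables and the operands already evaluated while a
    later operand is computed. *)
Definition comp_spec (sm : seq bool) (t : tm) (vs : seq nat) (o : nat)
    (c : cmd) (e : nat) : Prop :=
  forall L s, 1 < L -> env_ok L sm (map (regs s) vs) -> mem_ok L (Defs.mem s) ->
  exists s' k, [/\ exec c s s' k, Defs.mem s' = Defs.mem s,
    regs s' o = den (map (regs s) vs) (Defs.mem s) t,
    forall j, j < o -> regs s' j = regs s j & k <= L ^ e].

(** The product of successors dominates both the linear charge of sums and the schoolbook charge of
    products, so that all four operations are treated alike. *)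
Definition op_spec (op : expr -> expr -> expr) (f : nat -> nat -> nat) : Prop :=
  forall s a b, eval s (op a b) = f (eval s a) (eval s b) /\
    ecost s (op a b) <= ecost s a + ecost s b
      + (bitlen (eval s a)).+1 * (bitlen (eval s b)).+1.

Lemma add_spec : op_spec Add addn. Proof. by move=> s a b; split=> //=; lia. Qed.
Lemma sub_spec : op_spec Defs.Sub subn. Proof. by move=> s a b; split=> //=; lia. Qed.
Lemma mul_spec : op_spec Mul muln. Proof. by move=> s a b; split=> //=; lia. Qed.
Lemma div_spec : op_spec Div divn. Proof. by move=> s a b; split=> //=; lia. Qed.

Lemma map_regs_eq s s' vs o : all (fun v => v < o) vs ->
  (forall j, j < o -> regs s' j = regs s j) -> map (regs s') vs = map (regs s) vs.
Proof. by move=> /allP vo H; apply/eq_in_map => v /vo /H. Qed.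

Lemma comp_spec_leq sm t vs o c e e' : e <= e' -> comp_spec sm t vs o c e ->
  comp_spec sm t vs o c e'.
Proof.
move=> ee H L s L1 er mr; have [s' [k [H1 H2 H3 H4 H5]]] := H L s L1 er mr.
by exists s', k; split=> //; apply: leq_trans H5 _; rewrite leq_pexp2l // ltnW.
Qed.

Lemma comp_op_correct op f sm t a b vs o ca cb ea eb da db d :
  op_spec op f -> size vs = size sm -> all (fun v => v < o) vs ->
  (forall r m, den r m t = f (den r m a) (den r m b)) ->
  den_bounded sm a da -> den_bounded sm b db -> den_bounded sm t d ->
  comp_spec sm a vs o ca ea -> comp_spec sm b vs o.+1 cb eb ->
  exists e, comp_spec sm t vs o (comp_op op ca cb o) e.
Proof.
move=> opf sz vo tE Da Db Dt Ha Hb; pose O := bitlen o + bitlen o.+1.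
have [e He] : poly_bounded (fun L => L ^ ea + (L ^ eb + (1 + (O + (L ^ da + L ^ db) + (L ^ da + 1) * (L ^ db + 1)) + O + L ^ d))).
  by poly_tac.
exists e => L s L1 er mr; set r := map (regs s) vs in er *.
have [s1 [k1 [x1 m1 r1 p1 q1]]] := Ha L s L1 er mr.
have rE : map (regs s1) vs = r by apply: map_regs_eq p1.
have er1 : env_ok L sm (map (regs s1) vs) by rewrite rE.
have mr1 : mem_ok L (Defs.mem s1) by rewrite m1.
have [s2 [k2 [x2 m2 r2 p2 q2]]] := Hb L s1 L1 er1 mr1.
have sr : size r = size sm by rewrite size_map.
have [A _] := Da L r _ L1 sr er mr.
have [B _] := Db L r _ L1 sr er mr.
have [T _] := Dt L r _ L1 sr er mr.
rewrite rE m1 in r2.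
have r1' : regs s2 o = den r (Defs.mem s) a by rewrite p2.
have [E1 E2] := opf s2 (Reg o) (Reg o.+1).
exists (State (upd (regs s2) o (eval s2 (op (Reg o) (Reg o.+1)))) (Defs.mem s2)).
eexists; split.
- exact: exec_seq x1 (exec_seq x2 (exec_assign _ _ _)).
- by rewrite /= m2.
- by rewrite /= upd_eq E1 /= r1' r2 tE.
- by move=> j jo; rewrite /= upd_neq ?p2 ?p1 // ?ltnS 1?ltnW // neq_ltn jo.
- apply: leq_trans (He _ L1).
  rewrite E1 /= r1' r2 -tE; rewrite /= r1' r2 in E2.
  rewrite -/r /O in A B T q1 q2 E2 *.
  have P : (bitlen (den r (Defs.mem s) a)).+1 * (bitlen (den r (Defs.mem s) b)).+1 <= (L ^ da + 1) * (L ^ db + 1).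
    by apply: leq_mul; rewrite addn1 ltnS.
  move: A B T q1 q2 E2 P; move: (_ * _) (_ * _) => x y; lia.
Qed.

(** The accumulator is charged in every iteration, so all prefixes of the fold need a bit bound. A
    bound on the final value would not do: a product may end in 0 after large intermediate
    values. *)
Lemma comp_fold_correct op f k0 sm t c b vs o cc cb ec eb dc db :
  op_spec op f -> size vs = size sm -> all (fun v => v < o) vs ->
  small sm c ->
  (forall (r : seq nat) m, den r m t = \big[f/k0]_(i < den r m c) den (rcons r i) m b) ->
  (forall (r : seq nat) m i, \big[f/k0]_(j < i.+1) den (rcons r j) m b =
      f (\big[f/k0]_(j < i) den (rcons r j) m b) (den (rcons r i) m b)) ->
  den_bounded sm c dc -> den_bounded (rcons sm true) b db ->
  (exists d, forall L (r : seq nat) m, 1 < L -> size r = size sm -> env_ok L sm r ->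
      mem_ok L m -> forall i, i <= den r m c ->
      bitlen (\big[f/k0]_(j < i) den (rcons r j) m b) <= L ^ d) ->
  comp_spec sm c vs o cc ec -> comp_spec (rcons sm true) b (rcons vs o.+1) o.+3 cb eb ->
  exists e, comp_spec sm t vs o (comp_fold op k0 cc cb o) e.
Proof.
move=> opf sz vo sc tE tS Dc Db [d Dd] Hc Hb.
pose O := bitlen o + bitlen o.+1 + bitlen o.+2 + bitlen o.+3 + bitlen k0.
pose Kb := fun L => (L ^ dc.+1) ^ eb + (1 + (O + (L ^ d + (L ^ dc.+1) ^ db) + (L ^ d + 1) * ((L ^ dc.+1) ^ db + 1)) + O + L ^ d).
have pK : poly_bounded Kb.
  rewrite /Kb;
    do !first [apply: poly_add | apply: poly_mul | apply: poly_const | apply: poly_exp].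
  - by exists (dc.+1 * eb) => L _; rewrite expnM.
  - by exists (dc.+1 * db) => L _; rewrite expnM.
  - by exists (dc.+1 * db) => L _; rewrite expnM.
have [e He] : poly_bounded (fun L => L ^ ec + ((1 + O + O + O) + ((L ^ dc + 1) * (Kb L + 20 * (O + L ^ dc)) + (1 + O + O + L ^ d + L ^ d)))).
  by do !first [exact: pK | apply: poly_add | apply: poly_mul | apply: poly_const | apply: poly_exp].
exists e => L s L1 er mr; set r := map (regs s) vs in er *; set m := Defs.mem s in mr *.
have sr : size r = size sm by rewrite size_map.
have [C1 /(_ sc) C2] := Dc L r m L1 sr er mr.
have Td := Dd L r m L1 sr er mr.
have [s1 [k1 [x1 m1 r1 p1 q1]]] := Hc L s L1 er mr.
set cnt := den r m c in C1 C2 Td.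
have L1' : 1 < L ^ dc.+1 by rewrite (leq_trans L1) ?leq_exp_self.
have LL := leq_exp_self dc L1.
have LE : L ^ dc <= L ^ dc.+1 by rewrite leq_pexp2l // ltnW.
pose I i s' := [/\ Defs.mem s' = m, regs s' o.+2 = \big[f/k0]_(j < i) den (rcons r j) m b
  & forall j, j < o -> regs s' j = regs s j].
pose s2 := set_reg o.+2 k0 s1.
have : exists s3 k3, [/\ exec (loop o (Seq cb (Assign o.+2 (op (Reg o.+2) (Reg o.+3))))) s2 s3 k3,
    I cnt s3 & k3 <= cnt.+1 * (Kb L + 20 * (bitlen o.+1 + bitlen cnt))].
  apply: exec_loop.
  - move=> i v s' [H1 H2 H3]; split=> //=; first by rewrite upd_neq // neq_ltn ltnSn orbT.
    by move=> j jo; rewrite upd_neq ?H3 // neq_ltn ltnS ltnW.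
  - move=> i s' ic so' si' [H1 H2 H3].
    have rE : map (regs s') (rcons vs o.+1) = rcons r i.
      by rewrite map_rcons si' (map_regs_eq vo H3).
    have iL : i <= L ^ dc.+1 by apply: leq_trans (ltnW ic) (leq_trans C2 LE).
    have er' : env_ok (L ^ dc.+1) (rcons sm true) (rcons r i).
      apply: env_ok_rcons => //; first exact: env_ok_leq er.
      by rewrite bitlen_le_pos // ltnW.
    have mr' : mem_ok (L ^ dc.+1) m by apply: mem_ok_leq mr.
    have er1 : env_ok (L ^ dc.+1) (rcons sm true) (map (regs s') (rcons vs o.+1)) by rewrite rE.
    have mr1 : mem_ok (L ^ dc.+1) (Defs.mem s') by rewrite H1.
    have [s4 [k4 [x4 m4 r4 p4 q4]]] := Hb _ s' L1' er1 mr1.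
    have sr' : size (rcons r i) = size (rcons sm true) by rewrite !size_rcons sr.
    have [B _] := Db _ (rcons r i) m L1' sr' er' mr'.
    rewrite rE H1 in r4.
    have o2 : regs s4 o.+2 = \big[f/k0]_(j < i) den (rcons r j) m b by rewrite p4.
    have [E1 E2] := opf s4 (Reg o.+2) (Reg o.+3).
    exists (State (upd (regs s4) o.+2 (eval s4 (op (Reg o.+2) (Reg o.+3)))) (Defs.mem s4)).
    eexists; split.
    + exact: exec_seq x4 (exec_assign _ _ _).
    + by rewrite /= upd_neq ?p4 // ?neq_ltn ?ltnS ?leqnSn // ltnW.
    + by rewrite /= upd_neq ?p4 // neq_ltn ltnSn.
    + split=> /=; first by rewrite m4.
        by rewrite upd_eq E1 /= o2 r4 tS.
      move=> j jo; have jo3 : j < o.+3 by lia.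
      by rewrite upd_neq ?p4 ?H3 // neq_ltn; apply/orP; left; lia.
    + rewrite E1 /= o2 r4 -tS; rewrite /= o2 r4 in E2.
      have T1 := Td i (ltnW ic); have T2 := Td i.+1 ic.
      have P : (bitlen (\big[f/k0]_(j < i) den (rcons r j) m b)).+1 * (bitlen (den (rcons r i) m b)).+1 <= (L ^ d + 1) * ((L ^ dc.+1) ^ db + 1).
        by apply: leq_mul; rewrite addn1 ltnS.
      rewrite /Kb /O; move: E2 T1 T2 P q4 B; move: (_ * _) (_ * _) => x y; lia.
  - by rewrite /= upd_neq ?r1 // neq_ltn ltnS leqnSn.
  - split; rewrite /= ?upd_eq ?big_ord0 //.
    by move=> j jo; rewrite upd_neq ?p1 // neq_ltn; apply/orP; left; lia.
move=> [s3 [k3 [x3 [m3 r3 p3] q3]]].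
exists (set_reg o (eval s3 (Reg o.+2)) s3); eexists; split.
- apply: exec_seq x1 (exec_seq _ (exec_seq x3 (exec_assign _ _ _))).
  exact: (exec_assign _ _ (Const k0)).
- exact: m3.
- by rewrite /= upd_eq r3 tE.
- by move=> j jo; rewrite /= upd_neq ?p3 // neq_ltn jo.
apply: leq_trans (He _ L1); apply: leq_add => //; apply: leq_add.
  by rewrite /O /=; lia.
apply: leq_add.
  apply: leq_trans q3 _; apply: leq_mul; first by rewrite addn1 ltnS.
  by rewrite leq_add2l leq_mul2l /=; apply: leq_add => //; rewrite /O; lia.
rewrite /= r3; have := Td cnt (leqnn _); rewrite /O; lia.
Qed.
Lemma comp_args_correct sm (a : nat -> tm) vs o k e :
  size vs = size sm -> all (fun v => v < o) vs ->
  (forall i, i < k -> comp_spec sm (a i) vs (o + i) (compile vs (o + i) (a i)) e) ->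
  forall L, 1 < L -> forall d i s, i + d = k ->
    env_ok L sm (map (regs s) vs) -> mem_ok L (Defs.mem s) ->
    exists s' k', [/\ exec (seqs (fun i => compile vs (o + i) (a i)) i d) s s' k',
      Defs.mem s' = Defs.mem s,
      forall j, i <= j < k -> regs s' (o + j) = den (map (regs s) vs) (Defs.mem s) (a j),
      forall j, j < o + i -> regs s' j = regs s j & k' <= d * L ^ e + 1].
Proof.
move=> sz vo H L L1; elim=> [|d IH] i s.
  rewrite addn0 => -> er mr; exists s, 1; split=> //=; first exact: exec_skip.
  by move=> j /andP[/leq_ltn_trans ij /ij]; rewrite ltnn.
move=> id er mr; have ik : i < k by lia.
have [s1 [k1 [x1 m1 r1 p1 q1]]] := H i ik L s L1 er mr.
have rE : map (regs s1) vs = map (regs s) vs.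
  by apply: map_regs_eq vo _ => j jo; rewrite p1 // (leq_trans jo) ?leq_addr.
have idS : i.+1 + d = k by lia.
have er1 : env_ok L sm (map (regs s1) vs) by rewrite rE.
have mr1 : mem_ok L (Defs.mem s1) by rewrite m1.
have [s2 [k2 [x2 m2 r2 p2 q2]]] := IH i.+1 s1 idS er1 mr1.
exists s2, (k1 + k2); split=> /=; first exact: exec_seq x1 x2.
- by rewrite m2.
- move=> j /andP[]; rewrite leq_eqVlt => /orP[/eqP <- _|ij jk].
    by rewrite p2 // ltn_add2l.
  by rewrite r2 ?ij // rE m1.
- move=> j ji; rewrite p2 ?p1 //; lia.
- by rewrite mulSn -addnA leq_add.
Qed.

Lemma map_iota_regs f o k (g : nat -> nat) :
  (forall j, j < k -> f (o + j) = g j) -> map f (iota o k) = mkseq g k.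
Proof.
move=> H; rewrite /mkseq -[in LHS](addn0 o) iotaDl -map_comp.
by apply/eq_in_map => j; rewrite mem_iota add0n /= => jk; apply: H.
Qed.

Lemma comp_correct t sm vs o : wt sm t -> size vs = size sm ->
  all (fun v => v < o) vs -> exists e, comp_spec sm t vs o (compile vs o t) e.
Proof.
elim: t sm vs o => [i|k|a IHa b IHb|a IHa b IHb|a IHa b IHb|a IHa b IHb|a IHa|a IHa b IHb|a IHa b IHb|k a IHa b IHb] sm vs o wtt sz vo.
- have [e He] : poly_bounded (fun L => 1 + bitlen (nth 0 vs i) + L + bitlen o + L) by poly_tac.
  exists e => L s L1 er mr; eexists; eexists; split; first exact: exec_assign.
  + by [].
  + by rewrite /= upd_eq (nth_map 0) // sz.
  + by move=> j jo; rewrite /= upd_neq // neq_ltn jo.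
  + apply: leq_trans (He _ L1) => /=; have [H _] := er i.
    by move: H; rewrite (nth_map 0) ?sz //; lia.
- have [e He] : poly_bounded (fun L => 1 + bitlen k + bitlen o + bitlen k) by poly_tac.
  exists e => L s L1 er mr; eexists; eexists; split; first exact: exec_assign.
  + by [].
  + by rewrite /= upd_eq.
  + by move=> j jo; rewrite /= upd_neq // neq_ltn jo.
  + exact: He.
- have vo' : all (fun v => v < o.+1) vs by apply: sub_all vo => v; apply: ltnW.
  have [d Dt] := den_bound wtt; move: (wtt) => /= /andP[wa wb].
  have [da Da] := den_bound wa; have [db Db] := den_bound wb.
  have [ea Ha] := IHa sm vs o wa sz vo; have [eb Hb] := IHb sm vs o.+1 wb sz vo'.
  exact: (comp_op_correct (t := Plus a b) add_spec sz vo _ Da Db Dt Ha Hb).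
- have vo' : all (fun v => v < o.+1) vs by apply: sub_all vo => v; apply: ltnW.
  have [d Dt] := den_bound wtt; move: (wtt) => /= /andP[wa wb].
  have [da Da] := den_bound wa; have [db Db] := den_bound wb.
  have [ea Ha] := IHa sm vs o wa sz vo; have [eb Hb] := IHb sm vs o.+1 wb sz vo'.
  exact: (comp_op_correct (t := Minus a b) sub_spec sz vo _ Da Db Dt Ha Hb).
- have vo' : all (fun v => v < o.+1) vs by apply: sub_all vo => v; apply: ltnW.
  have [d Dt] := den_bound wtt; move: (wtt) => /= /andP[wa wb].
  have [da Da] := den_bound wa; have [db Db] := den_bound wb.
  have [ea Ha] := IHa sm vs o wa sz vo; have [eb Hb] := IHb sm vs o.+1 wb sz vo'.
  exact: (comp_op_correct (t := Times a b) mul_spec sz vo _ Da Db Dt Ha Hb).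
- have vo' : all (fun v => v < o.+1) vs by apply: sub_all vo => v; apply: ltnW.
  have [d Dt] := den_bound wtt; move: (wtt) => /= /andP[wa wb].
  have [da Da] := den_bound wa; have [db Db] := den_bound wb.
  have [ea Ha] := IHa sm vs o wa sz vo; have [eb Hb] := IHb sm vs o.+1 wb sz vo'.
  exact: (comp_op_correct (t := Quot a b) div_spec sz vo _ Da Db Dt Ha Hb).
- have [da Da] := den_bound (wtt : wt sm a); have [ea Ha] := IHa sm vs o wtt sz vo.
  have [e He] : poly_bounded (fun L => L ^ ea + (1 + (bitlen o + L ^ da + L ^ da + L) + bitlen o + L)) by poly_tac.
  exists e => L s L1 er mr; have [s1 [k1 [x1 m1 r1 p1 q1]]] := Ha L s L1 er mr.
  have sr : size (map (regs s) vs) = size sm by rewrite size_map.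
  have [A _] := Da L _ _ L1 sr er mr.
  eexists; eexists; split; first exact: exec_seq x1 (exec_assign _ _ _).
  + by rewrite /= m1.
  + by rewrite /= upd_eq r1 m1.
  + by move=> j jo; rewrite /= upd_neq ?p1 // neq_ltn jo.
  + apply: leq_trans (He _ L1); rewrite /= r1 m1; case: mr => mr _ _.
    have := mr (den (map (regs s) vs) (Defs.mem s) a); lia.
- move: (wtt) => /= /and3P[wa sa wb].
  have [da Da] := den_bound wa; have [db Db] := den_bound wb.
  have sz' : size (rcons vs o.+1) = size (rcons sm true) by rewrite !size_rcons sz.
  have vo' : all (fun v => v < o.+3) (rcons vs o.+1).
    by rewrite all_rcons leqnSn; apply: sub_all vo => v vo; rewrite (leq_trans vo) // !leqW.
  have [ea Ha] := IHa sm vs o wa sz vo.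
  have [eb Hb] := IHb _ _ _ wb sz' vo'.
  apply: (comp_fold_correct (t := Sum a b) (k0 := 0) add_spec sz vo sa _ _ Da Db _ Ha Hb) => //.
    by move=> r m i; rewrite big_ord_recr.
  have [d Hd] : poly_bounded (fun L => L ^ da + (L ^ da.+1) ^ db).
    by do !first [apply: poly_add | apply: poly_mul | apply: poly_const | apply: poly_exp];
      exists (da.+1 * db) => L _; rewrite expnM.
  exists d => L r m L1 sr er mr i ia; apply: leq_trans (Hd _ L1).
  have L0 : 0 < (L ^ da.+1) ^ db by rewrite !expn_gt0 ltnW.
  have [_ /(_ sa) A] := Da L r m L1 sr er mr.
  apply: leq_trans (bitlen_sum (F := fun i => den (rcons r i) m b) L0 _) _.
    by move=> j ji; case: (body_bounded sa Da Db L1 sr er mr (leq_trans ji ia)).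
  by rewrite leq_add2r (leq_trans ia).
- move: (wtt) => /= /and3P[wa sa wb].
  have [da Da] := den_bound wa; have [db Db] := den_bound wb.
  have sz' : size (rcons vs o.+1) = size (rcons sm true) by rewrite !size_rcons sz.
  have vo' : all (fun v => v < o.+3) (rcons vs o.+1).
    by rewrite all_rcons leqnSn; apply: sub_all vo => v vo; rewrite (leq_trans vo) // !leqW.
  have [ea Ha] := IHa sm vs o wa sz vo.
  have [eb Hb] := IHb _ _ _ wb sz' vo'.
  apply: (comp_fold_correct (t := Prod a b) (k0 :=
    1) mul_spec sz vo sa _ _ Da Db _ Ha Hb) => //.
    by move=> r m i; rewrite big_ord_recr.
  have [d Hd] : poly_bounded (fun L => L ^ da * (L ^ da.+1) ^ db + 1).
    by do !first [apply: poly_add | apply: poly_mul | apply: poly_const | apply: poly_exp];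
      exists (da.+1 * db) => L _; rewrite expnM.
  exists d => L r m L1 sr er mr i ia; apply: leq_trans (Hd _ L1).
  have L0 : 0 < (L ^ da.+1) ^ db by rewrite !expn_gt0 ltnW.
  have [_ /(_ sa) A] := Da L r m L1 sr er mr.
  apply: leq_trans (bitlen_prod (F := fun i => den (rcons r i) m b) L0 _) _.
    by move=> j ji; case: (body_bounded sa Da Db L1 sr er mr (leq_trans ji ia)).
  by rewrite addn1 ltnS leq_mul2r (leq_trans ia) ?orbT.
- move: (wtt) => /= /andP[/allP wa wb].
  have wa' i : i < k -> wt sm (a i) by move=> ik; apply: wa; rewrite mem_iota.
  have [da Da] : exists c, forall i, i < k -> den_bounded sm (a i) c.
    apply: bounded_choice; first by move=> *; apply: den_bounded_leq; eassumption.
    by move=> i ik; apply/den_bound/wa'.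
  have [ea Ha] : exists c, forall i, i < k ->
    comp_spec sm (a i) vs (o + i) (compile vs (o + i) (a i)) c.
    apply: bounded_choice; first by move=> *; apply: comp_spec_leq; eassumption.
    move=> i ik; apply: IHa (wa' i ik) sz _.
    by apply: sub_all vo => v /leq_trans; apply; rewrite leq_addr.
  have sz' : size (iota o k) = size (mkseq (fun i => small sm (a i)) k) by rewrite size_iota size_mkseq.
  have vo' : all (fun v => v < o + k) (iota o k) by apply/allP => v;
    rewrite mem_iota => /andP[].
  have [eb Hb] := IHb _ _ _ wb sz' vo'.
  have [d Dd] := den_bound wtt.
  have [e He] : poly_bounded (fun L => k * L ^ ea + 1 + ((L ^ da.+1) ^ eb + (1 + (bitlen (o + k) + L ^ d) + bitlen o + L ^ d))).
    by do !first [apply: poly_add | apply: poly_mul | apply: poly_const | apply: poly_exp];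
      exists (da.+1 * eb) => L _; rewrite expnM.
  exists e => L s L1 er mr.
  have [s1 [k1 [x1 m1 r1 p1 q1]]] := comp_args_correct sz vo Ha L1 (add0n k) er mr.
  have sr : size (map (regs s) vs) = size sm by rewrite size_map.
  have LL := leq_exp_self da L1.
  have L1' : 1 < L ^ da.+1 := leq_trans L1 LL.
  have rE : map (regs s1) (iota o k) = mkseq (fun i => den (map (regs s) vs) (Defs.mem s) (a i)) k.
    by apply: map_iota_regs => j jk; apply: r1.
  have er1 : env_ok (L ^ da.+1) (mkseq (fun i => small sm (a i)) k) (map (regs s1) (iota o k)).
    rewrite rE; apply: env_ok_mkseq => [|i ik]; first exact: ltnW.
    exact: (den_bounded_leq (leqnSn da) (Da i ik)).
  have mr1 : mem_ok (L ^ da.+1) (Defs.mem s1) by rewrite m1; apply: mem_ok_leq mr.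
  have [s2 [k2 [x2 m2 r2 p2 q2]]] := Hb _ s1 L1' er1 mr1.
  rewrite rE m1 in r2.
  eexists; eexists; split; first exact: exec_seq x1 (exec_seq x2 (exec_assign _ _ _)).
  + by rewrite /= m2 m1.
  + by rewrite /= upd_eq r2.
  + move=> j jo; rewrite /= upd_neq ?p2 ?p1 ?addn0 //; last by rewrite neq_ltn jo.
    by rewrite (leq_trans jo) ?leq_addr.
  + apply: leq_trans (He _ L1); rewrite /= r2.
    by have [D _] := Dd L _ _ L1 sr er mr; move: D => /=; lia.
Qed.

(** * Bridges and colourings *)

Section Bridges.
Variables (V : finType).
Implicit Types (e : rel V) (u v : V).

Definition del_edge e u v : rel V :=
  fun x y => [&& e x y, (x, y) != (u, v) & (x, y) != (v, u)].

Lemma del_edge_sub e u v : subrel (del_edge e u v) e.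
Proof. by move=> x y /and3P[]. Qed.

Lemma del_edge_simple e u v : simple_graph e -> simple_graph (del_edge e u v).
Proof.
move=> [es ei]; split=> [x y|x]; rewrite /del_edge; last by rewrite ei.
rewrite es !xpair_eqE; congr (_ && _).
by rewrite andbC (andbC (y == v)) (andbC (y == u)).
Qed.

Lemma simple_connect_sym e : simple_graph e -> connect_sym e.
Proof. by move=> [es _]; exact: sym_connect_sym. Qed.

Lemma forest_sub e e' : simple_graph e' -> subrel e' e -> forest e -> forest e'.
Proof.
move=> s' sub [_ H]; split=> // s /andP[c us]; apply: H; rewrite /ucycle us andbT.
exact: sub_cycle c.
Qed.

(** A repetition-free path around the edge would close up with it to a cycle. *)
Lemma forest_bridge e u v : forest e -> e u v -> ~~ connect (del_edge e u v) u v.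
Proof.
move=> [[es ei] H] uv; apply/negP => /connectP[p0 p0P].
case/shortenP: p0P => p pP up _ vE.
have: ucycle e (u :: p).
  rewrite /ucycle up andbT /= rcons_path (sub_path (@del_edge_sub e u v) pP) /=.
  by rewrite -vE es.
(* At most two vertices remain: one vertex would be a loop, and with two the path would use the
   deleted edge. *)
move/H; case: p pP up vE => [|w [|]] //=; first by move=> _ _ vu; rewrite vu ei in uv.
by move=> /andP[/and3P[_ + _] _] _ wE; rewrite wE eqxx.
Qed.

(** The first edge of the cycle will do, since the rest of the cycle joins its ends. *)
Lemma ucycle_edge e s : simple_graph e -> ucycle e s -> 2 < size s ->
  exists u v, e u v /\ connect (del_edge e u v) u v.
Proof.
move=> es; case: s => [|x [|y [|z p]]] // /andP[cs us] _; exists x, y.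
have: path e x (rcons (y :: z :: p) x) by [].
rewrite rcons_path => /andP[/andP[xy yp] lx]; split=> //.
have xn w : w \in y :: z :: p -> w != x.
  by move=> wp; apply: contraL us => /eqP <-; rewrite /= wp.
have yn w : w \in z :: p -> w != y.
  by move=> wp; apply: contraL us => /eqP <-; rewrite /= wp andbF.
rewrite (simple_connect_sym (del_edge_simple x y es)).
apply/connectP; exists (rcons (z :: p) x); last by rewrite last_rcons.
(* Before the closing step the path avoids [x]; the closing step starts at a vertex other than
   [y]. *)
rewrite rcons_path; apply/andP; split.
  have sub : {in predC1 x &, subrel e (del_edge e x y)}.
    move=> a b /= ax bx ab.
    by rewrite /del_edge ab !xpair_eqE (negbTE ax) (negbTE bx) andbF.
  by apply: (@sub_in_path _ _ _ _ sub y (z :: p)); first by apply/allP.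
rewrite /del_edge lx !xpair_eqE.
have /negbTE -> := xn _ (mem_last y (z :: p)).
by have /negbTE -> := yn _ (mem_last z p); rewrite ?andbF.
Qed.

Lemma not_forest e : simple_graph e -> ~ forest e ->
  exists u v, e u v /\ connect (del_edge e u v) u v.
Proof.
move=> es nf; have [s Hs] : exists s : seq V, ~ (ucycle e s -> size s <= 2).
  by apply/existsNP => H; apply: nf.
move/not_implyP: Hs => [us /negP]; rewrite -ltnNge; exact: ucycle_edge.
Qed.

(** In contrast to [induced], the vertex type stays the same and vertices outside [A] become
    isolated, so that the graphs G-X for all X can be compared. *)
Definition restrict e (A : {set V}) : rel V := fun u v => [&& e u v, u \in A & v \in A].

Lemma restrict_simple e A : simple_graph e -> simple_graph (restrict e A).
Proof.
by move=> [es ei]; split=> [x y|x]; rewrite /restrict ?ei // es (andbC (x \in A)).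
Qed.

Lemma forest_induced e (A : {set V}) : simple_graph e ->
  forest (induced e A) <-> forest (restrict e A).
Proof.
move=> se; have [es ei] := se; split=> -[_ H].
  split; first exact: restrict_simple.
  move=> s /andP[cs us].
  (* Every vertex of a cycle has a restricted edge to its successor; hence the cycle lifts to the
     subtype. *)
  have sA x : x \in s -> x \in A by move=> /(next_cycle cs)/and3P[].
  have [s' sE] : exists s' : seq {x | x \in A}, s = map val s'.
    elim: s sA {cs us} => [|x s IH] sA; first by exists [::].
    have [|s' ->] := IH; first by move=> y ys; apply: sA; rewrite inE ys orbT.
    by exists (exist _ x (sA x (mem_head _ _)) :: s').
  subst s; rewrite size_map; apply: H; apply/andP; split;
    last by rewrite (map_inj_uniq val_inj) in us.
  move: cs; rewrite cycle_map; apply: sub_cycle => x y; by case/and3P.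
split; first by split=> [x y|x]; rewrite /induced; [apply: es|apply: ei].
move=> s /andP[cs us]; rewrite -(size_map val); apply: H.
rewrite /ucycle (map_inj_uniq val_inj) us andbT cycle_map.
apply: sub_cycle cs => x y xy; apply/and3P; split=> //; exact: valP.
Qed.

End Bridges.

(** * The cyclomatic number through two-colourings *)

Section Colourings.
Variable n : nat.
Implicit Types (e : rel 'I_n).

Definition colouring e (f : {ffun 'I_n -> bool}) : bool :=
  [forall u, forall v, e u v ==> (f u == f v)].

(* Adding an edge keeps the number of colourings if its ends are connected and halves it
   otherwise, so that #colourings = 2^(number of components). *)
Definition colourings e : {set {ffun 'I_n -> bool}} := [set f | colouring e f].

Definition edges e : {set 'I_n * 'I_n} := [set p : 'I_n * 'I_n | (p.1 < p.2) && e p.1 p.2].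

(** This is 2 to the cyclomatic number; [cycle_weightP] shows that the division is exact. *)
Definition cycle_weight e : nat := #|colourings e| * 2 ^ #|edges e| %/ 2 ^ n.

Lemma colouringP e (f : {ffun 'I_n -> bool}) : reflect (forall u v, e u v ->
  f u = f v) (colouring e f).
Proof.
apply: (iffP forallP) => [H u v uv|H u].
  by apply/eqP; move/forallP: (H u) => /(_ v); rewrite uv.
by apply/forallP => v; apply/implyP => /H ->.
Qed.

Lemma colouring_connect e (f : {ffun 'I_n -> bool}) u v : colouring e f -> connect e u v ->
  f u = f v.
Proof.
move=> /colouringP cf /connectP[p]; elim: p u => [|w p IH] u /=; first by move=> _ ->.
by case/andP=> /cf -> /IH.
Qed.

Lemma edges_del e u v : simple_graph e -> e u v ->
  #|edges e| = #|edges (del_edge e u v)|.+1.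
Proof.
move=> [es ei]; wlog uv : u v / u < v => [H euv|euv].
  have [uv|vu|uv] := ltngtP u v; first exact: H.
    rewrite (H v u) 1?es //; congr (_.+1); apply: eq_card => p; rewrite !inE.
    by rewrite /del_edge [in RHS]andbCA [X in _ && (_ && X)]andbC andbCA.
  by move: euv; rewrite (val_inj uv) ei.
rewrite (cardsD1 (u, v)) inE /= uv euv add1n; congr (_.+1).
apply: eq_card => -[x y]; rewrite !inE /= /del_edge.
have [[-> ->]|] := altP ((x, y) =P (v, u)).
  by rewrite (ltnNge v) ltnW //= !andbF.
by rewrite andbT; case: (x < y); rewrite /= ?andbF // andbC.
Qed.

Lemma colourings_del_connect e u v : simple_graph e -> e u v ->
  connect (del_edge e u v) u v -> colourings e = colourings (del_edge e u v).
Proof.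
move=> [es ei] euv c; apply/setP => f; rewrite !inE.
apply/idP/idP => [/colouringP H|H]; first by apply/colouringP => x y /del_edge_sub /H.
apply/colouringP => x y xy; have fuv := colouring_connect H c.
have [[-> ->] //|n1] := altP ((x, y) =P (u, v)).
have [[-> ->] //|n2] := altP ((x, y) =P (v, u)).
by apply: (colouringP _ _ H); rewrite /del_edge xy n1.
Qed.

(** Swapping the colours on the component of [u] exchanges the colourings that agree at [u] and [v]
    with those that do not, because [v] lies outside that component. *)
Lemma colourings_del_bridge e u v : simple_graph e -> e u v ->
  ~~ connect (del_edge e u v) u v ->
  #|colourings (del_edge e u v)| = 2 * #|colourings e|.
Proof.
move=> se euv nc; set e0 := del_edge e u v;
  have se0 : simple_graph e0 by apply: del_edge_simple.
pose flip (f : {ffun 'I_n -> bool}) := [ffun x => f x (+) connect e0 u x].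
have flipK : involutive flip by move=> f; apply/ffunP => x; rewrite !ffunE addbK.
have flipC f : f \in colourings e0 -> flip f \in colourings e0.
  rewrite !inE => /colouringP H; apply/colouringP => x y xy.
  rewrite !ffunE (H _ _ xy); congr (_ (+) _).
  by apply: same_connect_r; [apply: simple_connect_sym | apply: connect1].
have colE : colourings e = [set f in colourings e0 | f u == f v].
  apply/setP => f; rewrite !inE; apply/idP/andP => [/colouringP H|[/colouringP H /eqP fuv]].
    by split; [apply/colouringP => x y /del_edge_sub /H | rewrite (H _ _ euv)].
  apply/colouringP => x y xy.
  have [[-> ->] //|n1] := altP ((x, y) =P (u, v)).
  have [[-> ->] //|n2] := altP ((x, y) =P (v, u)).
  by apply: H; rewrite /e0 /del_edge xy n1.
rewrite -(cardsID [set f : {ffun 'I_n -> bool} | f u == f v] (colourings e0)).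
have -> : colourings e0 :&: [set f : {ffun 'I_n -> bool} | f u == f v] = colourings e.
  by rewrite colE; apply/setP => f; rewrite !inE.
have -> : colourings e0 :\: [set f : {ffun 'I_n -> bool} | f u == f v] = flip @: colourings e.
  apply/setP => f; apply/idP/imsetP => [|[g gC ->]].
    rewrite in_setD inE => /andP[fuv fC]; exists (flip f); last by rewrite flipK.
    rewrite colE inE flipC //= !ffunE connect0 (negbTE nc).
    by move: fuv; case: (f u); case: (f v).
  move: gC; rewrite colE inE => /andP[gC guv].
  rewrite in_setD flipC // andbT inE !ffunE connect0 (negbTE nc).
  by move: guv; case: (g u); case: (g v).
by rewrite card_imset ?mul2n ?addnn //; apply: inv_inj.
Qed.

Lemma no_edges e : simple_graph e -> #|edges e| = 0 -> forall u v, ~~ e u v.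
Proof.
move=> [es ei] /eqP; rewrite cards_eq0 => /eqP e0 u v; apply/negP => uv.
have [lt|gt|/val_inj eq] := ltngtP u v.
- have: (u, v) \in edges e by rewrite inE /= lt.
  by rewrite e0 inE.
- have: (v, u) \in edges e by rewrite inE /= gt es.
  by rewrite e0 inE.
- by rewrite eq ei in uv.
Qed.

(** Deleting a bridge leaves the left-hand side unchanged, deleting any other edge halves it;
    without edges it is 2^n. *)
Lemma cycle_weightP e : simple_graph e ->
  #|colourings e| * 2 ^ #|edges e| = 2 ^ n * cycle_weight e.
Proof.
move=> se; suff: 2 ^ n %| #|colourings e| * 2 ^ #|edges e|.
  by move=> /divnK <-; rewrite mulnC.
have [k] := ubnP #|edges e|; elim: k e se => // k IH e se ek.
have [e0|[p]] := set_0Vmem (edges e).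
  have ne := no_edges se; rewrite e0 cards0 muln1.
  have -> : colourings e = setT.
    apply/setP => f; rewrite !inE; apply/colouringP => x y.
    by rewrite (negbTE (ne _ _ _)) // e0 cards0.
  by rewrite cardsT card_ffun card_bool card_ord.
rewrite inE => /andP[_ uv].
have E := edges_del se uv; have := IH _ (del_edge_simple p.1 p.2 se).
rewrite E ltnS in ek *; move=> /(_ ek).
have [c|c] := boolP (connect (del_edge e p.1 p.2) p.1 p.2).
  by rewrite (colourings_del_connect se uv c) expnS mulnCA => /dvdn_mull.
by rewrite (colourings_del_bridge se uv c) expnS mulnCA mulnA.
Qed.

Lemma cycle_weight_del e u v : simple_graph e -> e u v ->
  cycle_weight e =
  (if connect (del_edge e u v) u v then 2 else 1) * cycle_weight (del_edge e u v).
Proof.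
move=> se uv; apply/eqP; rewrite -(@eqn_pmul2l (2 ^ n)) ?expn_gt0 // mulnCA.
have se0 := del_edge_simple u v se.
rewrite -!cycle_weightP // (edges_del se uv) expnS.
have [c|c] := ifPn; first by rewrite (colourings_del_connect se uv c) mulnCA.
by rewrite (colourings_del_bridge se uv c) mul1n mulnCA mulnA.
Qed.

(** A cycle contains an edge that is no bridge, which contributes a factor 2. In a forest all edges
    are bridges and can be deleted down to the empty graph, of weight 1. *)
Lemma odd_cycle_weight e : simple_graph e -> odd (cycle_weight e) = `[< forest e >].
Proof.
have [k] := ubnP #|edges e|; elim: k e => // k IH e ek se.
have [fe|nfe] := asboolP (forest e); last first.
  have [u [v [uv c]]] := not_forest se nfe.
  by rewrite (cycle_weight_del se uv) c mul2n odd_double.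
have [e0|[p]] := set_0Vmem (edges e).
  have ne : forall u v, ~~ e u v by apply: no_edges; rewrite ?e0 ?cards0.
  rewrite /cycle_weight e0 cards0 muln1.
  have -> : colourings e = setT.
    apply/setP => f; rewrite !inE; apply/colouringP => x y.
    by rewrite (negbTE (ne _ _)).
  by rewrite cardsT card_ffun card_bool card_ord divnn expn_gt0.
rewrite inE => /andP[_ uv]; have se0 := del_edge_simple p.1 p.2 se.
rewrite (cycle_weight_del se uv) (negbTE (forest_bridge fe uv)) mul1n.
rewrite IH //; last by move: ek; rewrite (edges_del se uv).
by apply/asboolP; apply: forest_sub se0 _ fe; apply: del_edge_sub.
Qed.

Lemma cycle_weight_bound e : simple_graph e -> cycle_weight e <= 2 ^ (n * n).
Proof.
move=> se; rewrite -(@leq_pmul2l (2 ^ n)) ?expn_gt0 // -cycle_weightP //.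
apply: leq_mul.
  by rewrite (leq_trans (max_card _)) // card_ffun card_bool card_ord.
by rewrite leq_exp2l // (leq_trans (max_card _)) // card_prod card_ord.
Qed.

End Colourings.

(** * Orderings of the nodes of a tree decomposition *)

Lemma connect_induced (V : finType) (e : rel V) (A : {set V}) (x y : {x | x \in A}) :
  connect (induced e A) x y -> connect (restrict e A) (val x) (val y).
Proof.
move=> /connectP[p]; elim: p x => [|z p IH] x /=; first by move=> _ ->; apply: connect0.
case/andP=> xz /IH H /H c; apply: connect_trans c; apply: connect1.
by apply/and3P; split; [exact: xz | exact: valP | exact: valP].
Qed.

Lemma connect_exit (V : finType) (e : rel V) (A : {pred V}) x y :
  connect e x y -> x \in A -> y \notin A ->
  exists u v, [/\ e u v, u \in A & v \notin A].
Proof.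
move=> /connectP[p]; elim: p x => [|z p IH] x /=; first by move=> _ -> ->.
case/andP=> xz pz ly xA yA; have [zA|zA] := boolP (z \in A); first exact: IH pz ly zA yA.
by exists x, z.
Qed.

Section TreeOrder.
Variables (N : nat) (T : rel 'I_N) (xs : nat -> 'I_N).
Hypothesis T_forest : forest T.
Hypothesis xs_inj : forall j k, j < N -> k < N -> xs j = xs k -> j = k.
Hypothesis xs_adj : forall k, 0 < k < N -> exists2 j, j < k & T (xs j) (xs k).

(** The choice of the first earlier neighbour is immaterial, by [parent_unique]. *)
Definition parent (k : nat) : nat := find (fun j => T (xs j) (xs k)) (iota 0 k).

Lemma parentP k : 0 < k < N -> parent k < k /\ T (xs (parent k)) (xs k).
Proof.
move=> kN; have [j jk Tj] := xs_adj kN.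
have h : has (fun j => T (xs j) (xs k)) (iota 0 k).
  by apply/hasP; exists j; rewrite ?mem_iota.
have pk : parent k < k by move: (h); rewrite has_find size_iota.
by split=> //; have := nth_find 0 h; rewrite nth_iota.
Qed.

(** Walking from parent to parent stays among the nodes before [k] and so never uses an edge at
    [xs k]. *)
Lemma prefix_connect k j i : k < N -> i < k ->
  connect (del_edge T (xs j) (xs k)) (xs 0) (xs i).
Proof.
move=> kN; have [m] := ubnP i; elim: m i => // m IH i im ik.
case: (posnP i) => [->|i0]; first exact: connect0.
have iN : 0 < i < N by rewrite i0 (ltn_trans ik).
have [pi Tp] := parentP iN.
have pk : parent i < k by apply: ltn_trans ik.
apply: connect_trans (IH _ (leq_trans pi im) pk) (connect1 _).
have nk l : l < k -> xs l != xs k.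
  move=> lk; apply/eqP => /xs_inj E; have lN := ltn_trans lk kN.
  by move: (lk); rewrite (E lN kN) ltnn.
by rewrite /del_edge Tp !xpair_eqE (negbTE (nk _ ik)) (negbTE (nk _ pk)) andbF.
Qed.

(** The earlier nodes hang together without this edge. It is a bridge, so reaching one of them from
    [xs k] would join its ends. *)
Lemma prefix_cut k j i : k < N -> j < k -> T (xs j) (xs k) -> i < k ->
  ~~ connect (del_edge T (xs j) (xs k)) (xs k) (xs i).
Proof.
move=> kN jk Tjk ik; have [sT _] := T_forest.
apply: contra (forest_bridge T_forest Tjk) => c.
have sym := simple_connect_sym (del_edge_simple (xs j) (xs k) sT).
rewrite (sym (xs k)) in c; apply: connect_trans c.
apply: connect_trans (prefix_connect j kN ik).
by rewrite sym; apply: prefix_connect.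
Qed.

(** A second earlier neighbour would lead from [xs k] to the earlier nodes around the bridge to the
    parent. *)
Lemma parent_unique k j : k < N -> j < k -> T (xs j) (xs k) = (parent k == j).
Proof.
move=> kN jk; have k0N : 0 < k < N by rewrite kN (leq_ltn_trans _ jk).
have [pk Tp] := parentP k0N.
apply/idP/eqP => [Tj|<- //]; apply/eqP; apply: contraT => npj.
have [[Ts _] _] := T_forest.
case/negP: (prefix_cut kN pk Tp jk); apply: connect1.
have pj : xs j != xs (parent k).
  apply: contra npj => /eqP/xs_inj E; have pN := ltn_trans pk kN.
    by rewrite (E (ltn_trans jk kN) pN).
have kj : xs k != xs (parent k).
  apply/eqP => /xs_inj E; have pN := ltn_trans pk kN.
  by move: (pk); rewrite -(E kN pN) ltnn.
by rewrite /del_edge Ts Tj !xpair_eqE (negbTE pj) (negbTE kj) andbF.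
Qed.

Lemma order_surj x : exists2 k, k < N & xs k = x.
Proof.
pose f (i : 'I_N) := xs i.
have fi : injective f by move=> i j /xs_inj E; apply: val_inj; apply: E.
exists (invF fi x); first exact: ltn_ord.
exact: (f_invF fi).
Qed.

Variables (V : finType) (B : 'I_N -> {set V}).
Hypothesis B_connected : forall v, connected (induced T [set x | v \in B x]).

(** The nodes whose bags contain [v] join [xs k] to an earlier node, which by [prefix_cut] is
    possible only through the parent of [k]. *)
Lemma running_intersection k i v : i < k -> k < N ->
  v \in B (xs k) -> v \in B (xs i) -> v \in B (xs (parent k)).
Proof.
move=> ik kN vk vi; have k0N : 0 < k < N by rewrite kN (leq_ltn_trans _ ik).
have [pk Tp] := parentP k0N; apply: contraT => vp.
case/negP: (prefix_cut kN pk Tp ik).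
have vk' : xs k \in [set x | v \in B x] by rewrite inE.
have vi' : xs i \in [set x | v \in B x] by rewrite inE.
pose I := fun x => x \in [set x | v \in B x].
have := connect_induced (@B_connected v (exist I _ vk') (exist I _ vi')).
apply: connect_sub => x y /and3P[xy]; rewrite !inE => vx vy; apply: connect1.
rewrite /del_edge xy !xpair_eqE.
have nx : x != xs (parent k) by apply: contraTneq vx => ->.
have ny : y != xs (parent k) by apply: contraTneq vy => ->.
by rewrite (negbTE nx) (negbTE ny) andbF.
Qed.

End TreeOrder.

(** * Elimination of vertices along a tree decomposition *)

Local Notation spins n := {ffun 'I_n -> 'I_3}.

(** A partial assignment on [K] is represented by the total one that is 0 elsewhere;
    [srestr K s == s] says that [s] is supported on [K]. Outside [K], 0 is a default and does not
    mean deletion. *)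
Definition srestr n (K : {set 'I_n}) (s : spins n) : spins n :=
  [ffun v => if v \in K then s v else ord0].

Lemma srestr_srestr n (K L : {set 'I_n}) s : srestr K (srestr L s) = srestr (K :&: L) s.
Proof. by apply/ffunP => v; rewrite !ffunE in_setI; case: (v \in K). Qed.

Lemma srestr_id n (K : {set 'I_n}) (s : spins n) :
  reflect (forall v, v \notin K -> s v = ord0) (srestr K s == s).
Proof.
apply: (iffP eqP) => [<- v vK|H]; first by rewrite ffunE (negbTE vK).
by apply/ffunP => v; rewrite ffunE; case: ifPn => // /H.
Qed.

Section Elimination.
Variables (n N : nat) (b : nat -> {set 'I_n}) (par : nat -> nat).
Variables (loc M : nat -> spins n -> nat).

Definition upto (K : nat) : {set 'I_n} := \bigcup_(j < K) b j.

Hypothesis par_lt : forall k, 0 < k < N -> par k < k.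
Hypothesis rip : forall k i v, i < k -> k < N -> v \in b k -> v \in b i -> v \in b (par k).
Hypothesis loc_srestr : forall k s, loc k (srestr (b k) s) = loc k s.
Hypothesis M_rec : forall k r, k < N -> M k r =
  \sum_(s | (srestr (b k) s == s) && (srestr (upto k) s == r))
     loc k s * \prod_(j < N | (k < j) && (par j == k)) M j (srestr (b j) s).

Lemma uptoP K v : reflect (exists2 j, j < K & v \in b j) (v \in upto K).
Proof.
apply: (iffP bigcupP) => [[j _ vj]|[j jK vj]]; first by exists j.
by exists (Ordinal jK).
Qed.

(* After the nodes K, ..., N-1 have been processed, these are the messages not yet
   consumed by their parent. *)
Definition pending (K j : nat) : bool := (K <= j) && ((j == 0) || (par j < K)).

(** Together with [pendingS_prod]: processing [K] replaces the messages of its children by its own,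
    while the later nodes with a parent before [K] form a common factor. *)
Lemma pending_prod K (F : nat -> nat) : K < N ->
  \prod_(j < N | pending K j) F j =
  F K * \prod_(j < N | (K < j) && (par j < K)) F j.
Proof.
move=> KN; rewrite (bigD1 (Ordinal KN)) /=; last first.
  by rewrite /pending leqnn; case: posnP => //= K0; rewrite par_lt ?K0.
congr (_ * _); apply: eq_bigl => j; rewrite /pending -val_eqE /=.
by rewrite ltn_neqAle eq_sym; case: (K =P j) => [->|]; rewrite ?andbF //=; lia.
Qed.

Lemma pendingS_prod K (F : nat -> nat) :
  \prod_(j < N | pending K.+1 j) F j =
  \prod_(j < N | (K < j) && (par j == K)) F j
  * \prod_(j < N | (K < j) && (par j < K)) F j.
Proof.
rewrite (bigID (fun j : 'I_N => par j == K)) /=.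
congr (_ * _); apply: eq_bigl => j; rewrite /pending; lia.
Qed.

(** Interpolates between the total weight at [N], where nothing is pending, and the message of the
    root at 0. *)
Definition inv K : nat :=
  \sum_(s | srestr (upto K) s == s)
    (\prod_(k < K) loc k s) * \prod_(j < N | pending K j) M j (srestr (b j) s).

Lemma supp_upto K s v : srestr (upto K) s == s -> s v != ord0 -> exists2 i, i < K & v \in b i.
Proof. by move=> /srestr_id H; apply: contraNP => nv; rewrite H //; apply/uptoP. Qed.

(** The vertices of [b K] that no earlier bag contains are summed out. The factor [G] sees only
    spins in [b K] and [H] only spins in [upto K], so [G] is summed separately for each assignment
    to [upto K]. *)
Lemma inv_step K : K < N -> inv K.+1 = inv K.
Proof.
move=> KN.
pose G s := loc K s * \prod_(j < N | (K < j) && (par j == K)) M j (srestr (b j) s).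
pose H s := (\prod_(k < K) loc k s)
  * \prod_(j < N | (K < j) && (par j < K)) M j (srestr (b j) s).
(* By [rip], a vertex in the bag of a child that occurs in some bag up to [K] lies in the bag of its
   parent [K]. *)
have Gm s : srestr (upto K.+1) s == s -> G (srestr (b K) s) = G s.
  move=> ss; rewrite /G loc_srestr; congr (_ * _); apply: eq_bigr => j /andP[Kj /eqP pj].
  congr (M j _); apply/ffunP => v; rewrite !ffunE; case: ifP => // vj.
  case: ifPn => // vK; apply/eqP; rewrite eq_sym; apply: contraNT vK => sv.
  have [i iK vi] := supp_upto ss sv; rewrite -pj.
  by apply: rip vi => //; apply: leq_trans iK Kj.
have bU k : k < K -> b k \subset upto K.
  by move=> kK; apply/subsetP => v vk; apply/uptoP; exists k.
have Hm s : srestr (upto K.+1) s == s -> H (srestr (upto K) s) = H s.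
  move=> ss; rewrite /H; congr (_ * _).
    apply: eq_bigr => k _; rewrite -loc_srestr srestr_srestr.
    by have /setIidPl -> := bU k (ltn_ord k); rewrite loc_srestr.
  apply: eq_bigr => j /andP[Kj pj].
  congr (M j _); apply/ffunP => v; rewrite !ffunE; case: ifP => // vj.
  case: ifPn => // vK; apply/eqP; rewrite eq_sym; apply: contraNT vK => sv.
  have [i iK vi] := supp_upto ss sv; apply/uptoP; exists (par j) => //.
  by apply: rip vi => //; apply: leq_trans iK Kj.
transitivity (\sum_(s | srestr (upto K.+1) s == s) G s * H s).
  apply: eq_bigr => s _;
    rewrite big_ord_recr /= (pendingS_prod K (fun j => M j (srestr (b j) s))).
  by rewrite /G /H (mulnC _ (loc K s)) mulnACA.
transitivity (\sum_(s | srestr (upto K) s == s) M K (srestr (b K) s) * H s); last first.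
  apply: eq_bigr => s _; rewrite (pending_prod (fun j => M j (srestr (b j) s)) KN).
  by rewrite /H mulnCA.
have UU : upto K.+1 = upto K :|: b K by rewrite /upto big_ord_recr.
rewrite (partition_big (srestr (upto K)) (fun s => srestr (upto K) s == s)) /=; last first.
  by move=> s _; rewrite srestr_srestr setIid.
apply: eq_bigr => t /srestr_id tU; rewrite M_rec // big_distrl /=.
(* Gluing with [t] is inverse to restriction to [b K]; it matches the index set of [M_rec] with the
   assignments that restrict to [t]. *)
pose h (x : spins n) : spins n := [ffun v => if v \in b K then x v else t v].
have hm x : srestr (b K) (h x) = srestr (b K) x.
  by apply/ffunP => v; rewrite !ffunE; case: (v \in b K).
rewrite (reindex_onto h (srestr (b K))) /=; last first.
  move=> s /andP[/srestr_id sU /eqP st]; apply/ffunP => v; rewrite !ffunE.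
  case: (boolP (v \in b K)) => // vK; rewrite -st ffunE; case: ifPn => // vU.
  by rewrite sU // UU inE negb_or vU vK.
apply: eq_big => [x|x /andP[/andP[hx /eqP ht] /eqP xb]].
  rewrite hm andbC; case: (srestr_id (b K) x) => //= xb.
  have -> /= : srestr (upto K.+1) (h x) == h x.
    apply/srestr_id => v; rewrite UU inE negb_or ffunE => /andP[vU vK].
    by rewrite (negbTE vK) tU.
  apply/eqP/eqP => E; apply/ffunP => v.
    rewrite !ffunE; move/ffunP: E => /(_ v); rewrite !ffunE.
    case: (boolP (v \in upto K)) => vU; case: (boolP (v \in b K)) => vK //.
    by move=> _; apply: xb.
  rewrite !ffunE; move/ffunP: E => /(_ v); rewrite !ffunE.
  case: (boolP (v \in upto K)) => vU; case: (boolP (v \in b K)) => vK //.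
  by rewrite tU.
by rewrite -(Gm (h x)) // -(Hm (h x)) // xb ht.
Qed.

Lemma elimination : 0 < N -> upto N = setT ->
  M 0 [ffun=> ord0] = \sum_s \prod_(k < N) loc k s.
Proof.
move=> N0 UN.
have invK K : K <= N -> inv (N - K) = inv N.
  elim: K => [|K IH] KN; first by rewrite subn0.
  by rewrite -IH ?(ltnW KN) // -inv_step; [congr inv|]; lia.
transitivity (inv 0).
  rewrite /inv.
  rewrite (big_pred1 [ffun=> ord0]) => [|s].
    rewrite big_ord0 mul1n (pending_prod (fun j => M j (srestr (b j) _)) N0).
    rewrite big_pred0 ?muln1 => [|j]; last by rewrite ltn0 andbF.
    by congr (M 0 _); apply/ffunP => v; rewrite !ffunE if_same.
  have -> : upto 0 = set0 by rewrite /upto big_ord0.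
  by rewrite eq_sym; congr (_ == _); apply/ffunP => v; rewrite !ffunE inE.
have := invK N (leqnn N); rewrite subnn => ->; rewrite /inv UN; apply: eq_big => [s|s _].
  by apply/srestr_id => v; rewrite inE.
rewrite [X in _ * X]big_pred0 ?muln1 // => j.
by rewrite /pending leqNgt ltn_ord.
Qed.

(* The product of the maxima of the pending messages grows by at most 3^n D with every
   processed node. *)
Lemma message_bound D : 0 < D -> (forall k s, loc k s <= D) ->
  forall k r, k < N -> M k r <= (3 ^ n * D) ^ N.
Proof.
move=> D0 locD; set Q := 3 ^ n * D.
have Q0 : 0 < Q by rewrite muln_gt0 expn_gt0.
(* With all factors at least 1, a single message is bounded by a product of pending ones. *)
pose mu j := maxn 1 (\max_(r : spins n) M j r).
have mu1 j : 0 < mu j by rewrite leq_max.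
have Mmu j r : M j r <= mu j by rewrite leq_max (leq_bigmax (F := M j)) orbT.
have mu_step k : k < N -> mu k <= Q * \prod_(j < N | (k < j) && (par j == k)) mu j.
  move=> kN; rewrite geq_max muln_gt0 Q0 prodn_gt0 //=.
  apply/bigmax_leqP => r _; rewrite M_rec //.
  set P := \prod_(j < N | _) mu j.
  apply: (@leq_trans (\sum_(s : spins n) D * P)); last first.
    by rewrite sum_nat_const card_ffun !card_ord mulnA.
  rewrite big_mkcond leq_sum // => s _; case: ifP => // _.
  by apply: leq_mul => //; apply: leq_prod.
have pend K : K <= N -> \prod_(j < N | pending (N - K) j) mu j <= Q ^ K.
  elim: K => [|K IH] KN.
    by rewrite subn0 big_pred0 // => j; rewrite /pending leqNgt ltn_ord.
  have kN : N - K.+1 < N by lia.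
  have kS : (N - K.+1).+1 = N - K by lia.
  rewrite pending_prod // expnS; apply: leq_trans (leq_mul (mu_step _ kN) (leqnn _)) _.
  by rewrite -mulnA -pendingS_prod kS leq_mul2l IH ?orbT // ltnW.
move=> k r kN; apply: leq_trans (Mmu k r) _.
apply: (@leq_trans (\prod_(j < N | pending (N - (N - k)) j) mu j)).
  by rewrite subKn ?(ltnW kN) // pending_prod // leq_pmulr // prodn_gt0.
apply: leq_trans (pend _ (leq_subr _ _)) _.
by rewrite leq_pexp2l // leq_subr.
Qed.

End Elimination.

Lemma prod_once N (c : nat -> bool) x k0 : k0 < N -> c k0 ->
  (forall k, k < N -> c k -> k = k0) -> \prod_(k < N) (if c k then x else 1) = x.
Proof.
move=> k0N ck0 cu; rewrite (bigD1 (Ordinal k0N)) //= ck0 big1 ?muln1 // => k.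
rewrite -val_eqE /= => kk0; case: ifP => // ck.
by rewrite (cu k) ?eqxx in kk0.
Qed.

(** * Distribution of the weight over the nodes *)

Section LocalWeights.
Variables (n N : nat) (b : nat -> {set 'I_n}) (par : nat -> nat) (e : rel 'I_n).
Variables (w : 'I_3 -> nat) (w2 : 'I_3 -> 'I_3 -> nat).
Hypothesis par_lt : forall k, 0 < k < N -> par k < k.
Hypothesis rip : forall k i v, i < k -> k < N -> v \in b k -> v \in b i -> v \in b (par k).
Hypothesis cover_vertex : forall v, exists2 k, k < N & v \in b k.
Hypothesis cover_edge : forall u v, e u v -> exists2 k, k < N & (u \in b k) && (v \in b k).

Definition new_vertex k v : bool := (v \in b k) && (v \notin upto b k).

(** The two ends are tested for earlier occurrences separately; by running intersection this is the
    same as asking for one earlier bag containing both. *)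
Definition new_edge k u v : bool :=
  [&& e u v, u \in b k, v \in b k & ~~ ((u \in upto b k) && (v \in upto b k))].

Definition local k (s : spins n) : nat :=
  (\prod_v (if new_vertex k v then w (s v) else 1))
  * \prod_(u : 'I_n) \prod_(v : 'I_n | v < u) (if new_edge k u v then w2 (s u) (s v) else 1).

Definition weight (s : spins n) : nat :=
  (\prod_v w (s v))
  * \prod_(u : 'I_n) \prod_(v : 'I_n | v < u) (if e u v then w2 (s u) (s v) else 1).

Lemma local_srestr k s : local k (srestr (b k) s) = local k s.
Proof.
congr (_ * _).
  by apply: eq_bigr => v _; rewrite /new_vertex ffunE; case: (v \in b k).
apply: eq_bigr => u _; apply: eq_bigr => v _.
rewrite /new_edge !ffunE; by case: (v \in b k); case: (u \in b k); rewrite ?andbF.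
Qed.

Lemma upto_cover : upto b N = setT.
Proof.
by apply/setP => v; rewrite inE; apply/uptoP; have [k kN vk] := cover_vertex v; exists k.
Qed.

Lemma prod_new_vertex v x : \prod_(k < N) (if new_vertex k v then x else 1) = x.
Proof.
have ex : exists k, (k < N) && (v \in b k).
  by have [k kN vk] := cover_vertex v; exists k; rewrite kN.
case: (ex_minnP ex) => k /andP[kN vk] kmin;
  apply: (@prod_once N (fun k => new_vertex k v) x k) => //.
  rewrite /new_vertex vk; apply/uptoP => -[j jk vj].
  by have := kmin j; rewrite vj (ltn_trans jk kN) leqNgt jk => /(_ isT).
move=> l lN /andP[vl vul]; apply/eqP; rewrite eqn_leq kmin ?lN ?vl // andbT leqNgt.
by apply: contra vul => kl; apply/uptoP; exists k.
Qed.

(** The edge is charged at the first node [k] whose bag contains both ends. If both ends occurred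
    earlier, the parent of [k] would contain both as well. *)
Lemma prod_new_edge u v x :
  \prod_(k < N) (if new_edge k u v then x else 1) = if e u v then x else 1.
Proof.
case: ifPn => euv; last first.
  by rewrite big1 // => k _; rewrite /new_edge (negbTE euv).
have ex : exists k, [&& k < N, u \in b k & v \in b k].
  by have [k kN vk] := cover_edge euv; exists k; rewrite kN.
case: (ex_minnP ex) => k /and3P[kN uk vk] kmin;
  apply: (@prod_once N (fun k => new_edge k u v) x k) => //.
  rewrite /new_edge euv uk vk; apply/negP => /andP[/uptoP[i ik ui] /uptoP[j jk vj]].
  have k0 : 0 < k < N by rewrite kN (leq_ltn_trans _ ik).
  have pk := par_lt k0; have := kmin (par k).
  rewrite (ltn_trans pk kN) (rip ik kN uk ui) (rip jk kN vk vj) => /(_ isT).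
  by rewrite leqNgt pk.
move=> l lN /and4P[_ ul vl nl]; apply/eqP.
rewrite eqn_leq kmin ?lN ?ul ?vl // andbT leqNgt.
by apply: contra nl => kl; apply/andP; split; apply/uptoP; exists k.
Qed.

Lemma prod_local s : \prod_(k < N) local k s = weight s.
Proof.
rewrite big_split /=; congr (_ * _).
  by rewrite exchange_big /=; apply: eq_bigr => v _; apply: prod_new_vertex.
rewrite exchange_big /=; apply: eq_bigr => u _.
by rewrite exchange_big /=; apply: eq_bigr => v _; apply: prod_new_edge.
Qed.

Lemma local_bound W : 0 < W -> (forall x, w x <= W) -> (forall x y, w2 x y <= 2) ->
  forall k s, local k s <= W ^ n * 2 ^ (n * n).
Proof.
move=> W0 wW w2W k s; apply: leq_mul.
  have -> : W ^ n = \prod_(v < n) W by rewrite prod_nat_const card_ord.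
  by apply: leq_prod => v _; case: ifP.
have -> : 2 ^ (n * n) = \prod_(u < n) \prod_(v < n) 2.
  by rewrite !prod_nat_const !card_ord expnM.
apply: leq_prod => u _; rewrite big_mkcond; apply: leq_prod => v _.
by case: ifP => // _; case: ifP.
Qed.

End LocalWeights.

(** * The partition function *)

Definition vertex_weight (x : nat) (s : 'I_3) : nat := if s == ord0 then 2 * x else 1.

Definition edge_weight (s s' : 'I_3) : nat :=
  if (s == ord0) || (s' == ord0) then 1 else if s == s' then 2 else 0.

Lemma inord_eq3 i j : i < 3 -> j < 3 -> (inord i == inord j :> 'I_3) = (i == j).
Proof. by move=> i3 j3; rewrite -val_eqE /= !inordK. Qed.

Section PartitionFunction.
Variables (n : nat) (e : rel 'I_n).
Hypothesis e_simple : simple_graph e.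
Implicit Types s : spins n.

Definition zeros (s : spins n) : {set 'I_n} := [set v | s v == ord0].

Definition consistent (s : spins n) : bool :=
  [forall u, forall v, [&& e u v, s u != ord0 & s v != ord0] ==> (s u == s v)].

Lemma prod_edge_weight s :
  \prod_(u : 'I_n) \prod_(v : 'I_n | v < u) (if e u v then edge_weight (s u) (s v) else 1)
  = if consistent s then 2 ^ #|edges (restrict e (~: zeros s))| else 0.
Proof.
rewrite pair_big_dep /=; case: ifPn => [/forallP cs|].
  (* [edges] lists the smaller end first, the product runs over pairs with the larger end first. *)
  pose sw (p : 'I_n * 'I_n) := (p.2, p.1).
  have swK : involutive sw by case.
  rewrite -(card_imset _ (inv_inj swK)) -sum1_card expn_sum [RHS]big_mkcond [LHS]big_mkcond.
  apply: eq_bigr => -[u v] _ /=; rewrite -[(u, v)](swK (u, v)) mem_imset; last exact: inv_inj.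
  rewrite inE /= /restrict !inE /edge_weight; have [es _] := e_simple; rewrite (es v u).
  case: (v < u) => //=; case: ifP => //= euv.
  have := forallP (cs u) v; rewrite euv /=.
  by case: (s u == ord0); case: (s v == ord0) => //= ->.
rewrite negb_forall => /existsP[u]; rewrite negb_forall => /existsP[v].
rewrite negb_imply => /andP[/and3P[euv su sv] suv].
have [es ei] := e_simple.
wlog vu : u v euv su sv suv / v < u => [H|].
  have [uv|vu|/val_inj uv] := ltngtP u v; last by rewrite uv ei in euv.
    by apply: (H v u) => //; rewrite 1?es 1?eq_sym.
  exact: (H u v).
rewrite (bigD1 (u, v)) //= euv /edge_weight (negbTE su) (negbTE sv) (negbTE suv).
by rewrite mul0n.
Qed.

Definition lift_colouring (X : {set 'I_n}) (f : {ffun 'I_n -> bool}) : spins n :=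
  [ffun v => if v \in X then ord0 else if f v then inord 2 else inord 1].

Lemma zeros_lift X f : zeros (lift_colouring X f) = X.
Proof.
apply/setP => v; rewrite inE ffunE; case: (v \in X); rewrite ?eqxx //.
by case: (f v); rewrite -val_eqE /= inordK.
Qed.

(* A colouring of G-X leaves the colours of the vertices in X free. *)
Lemma card_colourings X :
  #|colourings (restrict e (~: X))|
  = 2 ^ #|X| * #|[set s : spins n | (zeros s == X) && consistent s]|.
Proof.
rewrite -sum1_card (partition_big (lift_colouring X)
  (mem [set s : spins n | (zeros s == X) && consistent s])) /=; last first.
  move=> f; rewrite !inE zeros_lift eqxx => /colouringP cf /=.
  apply/forallP => u; apply/forallP => v; apply/implyP => /and3P[uv].
  rewrite !ffunE; case: ifP => // uX _; case: ifP => // vX _.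
  by rewrite (cf u v) // /restrict uv !inE uX vX.
rewrite mulnC -sum_nat_const; apply: eq_bigr => s.
rewrite inE => /andP[/eqP zs cs].
(* This describes the fibre of [lift_colouring X] over [s]: any colour on [X], a forced one
   elsewhere. *)
pose F (v : 'I_n) := [pred c : bool | (v \in X) || (c == (s v == inord 2))].
have s_cases v : v \notin X -> s v = if s v == inord 2 then inord 2 else inord 1.
  rewrite -zs !inE => n0; case: eqP => [-> //|n2]; apply: val_inj; rewrite /= inordK //.
  move: n2 n0; case: (s v) => -[|[|[|]]] //= i3 n2 n0.
  by case: n2; apply: val_inj; rewrite /= inordK.
transitivity #|family F|.
  rewrite sum1_card; apply: eq_card => f; rewrite [LHS]inE [_ \in colourings _]inE.
  have -> : (f \in family F) = (lift_colouring X f == s).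
    apply/familyP/eqP => [H|E v]; last first.
      rewrite !inE -E ffunE; case: (v \in X) => //=.
      by case: (f v); rewrite inord_eq3.
    apply/ffunP => v; rewrite ffunE; have := H v; rewrite inE /=.
    case: (boolP (v \in X)) => [|vX /eqP ->]; first by rewrite -zs inE => /eqP ->.
    by rewrite -s_cases.
  case: eqP; rewrite ?andbF // andbT => sE; apply/colouringP => u v.
  rewrite /restrict !inE => /and3P[uv uX vX].
  have := forallP (forallP cs u) v; rewrite uv -sE !ffunE (negbTE uX) (negbTE vX).
  by case: (f u); case: (f v); rewrite -!val_eqE /= !inordK //=; case.
rewrite card_family.
have -> : 2 ^ #|X| = \prod_(v : 'I_n) (if v \in X then 2 else 1).
  by rewrite -big_mkcond /= prod_nat_const.
rewrite foldrE big_map big_enum /=; apply: eq_bigr => v _; rewrite /F.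
case: ifPn => vX; first by rewrite -[RHS]card_bool; apply: eq_card.
by rewrite -[RHS](card1 (s v == inord 2)); apply: eq_card.
Qed.

Lemma partition_function x :
  \sum_s weight e (vertex_weight x) edge_weight s
  = 2 ^ n * \sum_(X : {set 'I_n}) x ^ #|X| * cycle_weight (restrict e (~: X)).
Proof.
rewrite (partition_big zeros predT) //= big_distrr /=; apply: eq_bigr => X _.
rewrite mulnCA -cycle_weightP; last exact: restrict_simple.
rewrite card_colourings; set m := #|edges _|.
transitivity (\sum_(s in [set s : spins n | (zeros s == X) && consistent s])
    ((2 * x) ^ #|X| * 2 ^ m)); last first.
  rewrite sum_nat_const expnMn.
  by move: #|[set s | _]| (2 ^ m) (2 ^ #|X|) (x ^ #|X|) => a c d f; lia.
rewrite [RHS]big_mkcond [LHS]big_mkcond; apply: eq_bigr => s _ /=.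
rewrite inE /weight prod_edge_weight; case: eqP => //= zs.
rewrite zs -/m; case: ifP => _; last by rewrite muln0.
rewrite /vertex_weight -big_mkcond /= prod_nat_const; congr (_ ^ _ * _).
by rewrite -zs; apply: eq_card => v; rewrite !inE.
Qed.

(** Sets with fewer than t elements contribute less than [x ^ t] in total and vanish in the
    division; sets with more keep a factor of the even number [x]. For the others, parity is the
    test for a forest. *)
Lemma count_modulo t x : 0 < t -> 2 %| x -> 2 ^ (n * n + n) < x ->
  ((\sum_s weight e (vertex_weight x) edge_weight s) %/ 2 ^ n %/ x ^ t) %% 2
  = #|fvs_of_size e t| %% 2.
Proof.
move=> t0 x2 xn; have x0 : 0 < x := leq_ltn_trans (leq0n _) xn.
pose q (X : {set 'I_n}) := cycle_weight (restrict e (~: X)).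
rewrite partition_function mulKn ?expn_gt0 //.
rewrite (bigID (fun X : {set 'I_n} => #|X| < t)) /=; set low := (X in X + _).
(* There are at most 2^n such sets, each with a term of at most x^(t-1) 2^(n*n); hence the lower
   bound on [x]. *)
have lowx : low < x ^ t.
  case: t t0 @low => // t _ low; rewrite expnSr.
  apply: leq_ltn_trans (_ : _ <= x ^ t * 2 ^ (n * n + n)) _; last first.
    by rewrite ltn_pmul2l // expn_gt0 x0.
  apply: (@leq_trans (\sum_(X : {set 'I_n}) x ^ t * 2 ^ (n * n))); last first.
    by rewrite sum_nat_const -cardsT -powersetT card_powerset cardsT card_ord mulnCA -expnD addnC.
  rewrite /low big_mkcond leq_sum // => X _; case: ifP => // Xt.
  apply: leq_mul; first by rewrite leq_pexp2l.
  by apply: cycle_weight_bound; apply: restrict_simple.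
pose hi := \sum_(X : {set 'I_n} | t <= #|X|) x ^ (#|X| - t) * q X.
have -> : \sum_(X : {set 'I_n} | ~~ (#|X| < t)) x ^ #|X| * cycle_weight (restrict e (~: X)) = hi * x ^ t.
  rewrite big_distrl; apply: eq_big => [X|X]; first by rewrite -leqNgt.
  by rewrite -leqNgt => Xt; rewrite [RHS]mulnAC -expnD subnK.
rewrite addnC divnMDl ?expn_gt0 ?x0 // divn_small // addn0 /hi -modn_summ.
congr (_ %% 2); rewrite -sum1_card [RHS]big_mkcond [LHS]big_mkcond /=.
apply: eq_bigr => X _; rewrite inE; case: (ltngtP t #|X|) => [tX|//|tX]; rewrite ?andbF //=.
  apply/eqP; rewrite -/(2 %| _); apply: dvdn_mulr.
  by rewrite -(subnKC tX) addSn -addnS addKn expnS dvdn_mulr.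
rewrite tX subnn expn0 mul1n andbT modn2 odd_cycle_weight; last exact: restrict_simple.
rewrite (asbool_equiv_eq (iff_sym (forest_induced (~: X) e_simple))).
by rewrite -/(feedback_vertex_set e X); case: asboolP.
Qed.

End PartitionFunction.

(** * The program *)

Definition tnot (a : tm) : tm := Minus (Cst 1) a.
Definition tbool (a : tm) : tm := tnot (tnot a).
Definition teq (a b : tm) : tm := tnot (Plus (Minus a b) (Minus b a)).
Definition tlt (a b : tm) : tm := tnot (Minus (Plus a (Cst 1)) b).
(** The default is 1 because conditionals occur only as factors of products. *)
Definition tif (c a : tm) : tm := Plus (Times c a) (tnot c).
Definition call (l : seq tm) (f : tm) : tm := Call (size l) (nth (Cst 0) l) f.
Definition tpow (a k : tm) : tm := call [:: a; k] (Prod (Var 1) (Var 0)).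
Definition tmod (d : nat) (a : tm) : tm :=
  call [:: a] (Minus (Var 0) (Times (Cst d) (Quot (Var 0) (Cst d)))).

Section Operators.
Variables (r : seq nat) (m : nat -> nat).

Lemma den_not a (c : bool) : den r m a = c -> den r m (tnot a) = ~~ c.
Proof. by move=> /= ->; case: c. Qed.

Lemma den_bool a : den r m (tbool a) = (den r m a != 0).
Proof. by rewrite /=; case: (den r m a). Qed.

Lemma den_eq a b : den r m (teq a b) = (den r m a == den r m b).
Proof.
rewrite /=; case: eqP => [->|ne]; first by rewrite subnn.
by have : den r m a - den r m b + (den r m b - den r m a) > 0; lia.
Qed.

Lemma den_lt a b : den r m (tlt a b) = (den r m a < den r m b).
Proof. rewrite /=; case: ltnP => H; lia. Qed.

Lemma den_and a b (c d : bool) : den r m a = c -> den r m b = d ->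
  den r m (Times a b) = (c && d).
Proof. by move=> /= -> ->; rewrite mulnb. Qed.

Lemma den_if c a (b : bool) : den r m c = b ->
  den r m (tif c a) = if b then den r m a else 1.
Proof. by move=> /= ->; case: b; rewrite ?mul1n ?subnn ?addn0. Qed.

Lemma den_call l f : den r m (call l f) = den [seq den r m a | a <- l] m f.
Proof.
rewrite /= -[in RHS](mkseq_nth (Cst 0) l) /mkseq -map_comp.
by congr den; apply: eq_map.
Qed.

Lemma den_pow a k : den r m (tpow a k) = den r m a ^ den r m k.
Proof. by rewrite /tpow den_call /= prod_nat_const card_ord. Qed.

Lemma den_mod d a : den r m (tmod d a) = den r m a %% d.
Proof.
rewrite /tmod den_call /= {1}(divn_eq (den r m a) d) mulnC addnC addnK //.
Qed.

End Operators.

(** Bounded search by sums and products: the inner product is 1 exactly for the [y] before the first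
    hit, so the sum counts up to it. *)
Lemma first_index (c : nat -> bool) N : (exists2 y, y < N & c y) ->
  let i := \sum_(y < N) \prod_(z < y.+1) (~~ c z : nat) in i < N /\ c i.
Proof.
move=> [y yN cy]; have ex : exists y, c y by exists y.
case: (ex_minnP ex) => i ci imin; have iN : i < N by apply: leq_ltn_trans (imin _ cy) yN.
have -> : \sum_(y < N) \prod_(z < y.+1) (~~ c z : nat) = i; last by [].
transitivity (\sum_(y < N) (y < i : nat)).
  apply: eq_bigr => z _; case: ltnP => zi.
    rewrite big1 // => l _; case: (boolP (c l)) => // /imin il.
    by have := ltn_ord l; lia.
  by rewrite (bigD1 (Ordinal (zi : i < z.+1))) //= ci.
rewrite -[in RHS](card_ord i) -sum1_card (big_ord_widen N (fun=> 1) (ltnW iN)).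
by rewrite [RHS]big_mkcond; apply: eq_bigr => z _; case: (z < i).
Qed.

Definition tn : tm := Rd (Cst 0).
Definition tN : tm := Rd (Cst 1).
Definition tG (u v : tm) : tm := tbool (Rd (Plus (Cst 2) (Plus (Times u tn) v))).
Definition tT (x y : tm) : tm :=
  tbool (Rd (Plus (Plus (Cst 2) (Times tn tn)) (Plus (Times x tN) y))).
Definition tB (x v : tm) : tm :=
  tbool (Rd (Plus (Plus (Plus (Cst 2) (Times tn tn)) (Times tN tN)) (Plus (Times x tn) v))).
Definition tdigits : tm :=
  Plus (Plus (Plus (Cst 2) (Times tn tn)) (Times tN tN)) (Times tN tn).
Definition tdigit (i : tm) : tm := Rd (Plus tdigits i).
(** If t is at most n, its digits and the terminator fit into n + 2 cells, and the cells from here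
    on are still 0. *)
Definition tbase : tm := Plus tdigits (Plus tn (Cst 2)).
(* The cells from [tbase] on hold the N nodes in the order found, and behind them the
   messages: entry c of the message of node k is cell c N + k. *)
Definition tord (k : tm) : tm := Rd (Plus tbase k).
Definition tcell (k c : tm) : tm := Plus (Plus tbase tN) (Plus (Times c tN) k).

Definition tcand (k y : tm) : tm :=
  Times (tnot (call [:: k; y] (Sum (Var 0) (teq (tord (Var 2)) (Var 1)))))
    (tbool (Plus (tnot k) (call [:: k; y] (Sum (Var 0) (tT (tord (Var 2)) (Var 1)))))).

Definition tnext (k : tm) : tm :=
  call [:: k] (Sum tN (Prod (Plus (Var 1) (Cst 1)) (tnot (tcand (Var 0) (Var 2))))).

Definition tbag (k v : tm) : tm := tB (tord k) v.
Definition trank (k v : tm) : tm := call [:: k; v] (Sum (Var 1) (tbag (Var 0) (Var 2))).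
Definition tkept (k v : tm) : tm :=
  tbool (call [:: k; v] (Sum (Var 0) (tbag (Var 2) (Var 1)))).
(* The spins of the bag of node k are the ternary digits of a, those outside are 0. *)
Definition tspin (k a v : tm) : tm :=
  Times (tbag k v) (tmod 3 (Quot a (tpow (Cst 3) (trank k v)))).

(** The digits stand at the number of the vertex in the graph and not at its rank in the bag, so
    that sender and receiver compute the same index. Addresses become sparse, but keep polynomially
    many bits. *)
Definition tkeptcode (k a : tm) : tm :=
  call [:: k; a] (Sum tn (Times (Times (tkept (Var 0) (Var 2)) (tspin (Var 0) (Var 1) (Var 2)))
    (tpow (Cst 3) (Var 2)))).
Definition tchildcode (j k a : tm) : tm :=
  call [:: j; k;
    a] (Sum tn (Times (Times (tbag (Var 0) (Var 3)) (tspin (Var 1) (Var 2) (Var 3)))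
    (tpow (Cst 3) (Var 3)))).

(** The exponent (n+1)^2 exceeds n*n + n, as [count_modulo] requires, and is positive even for n =
    0. *)
Definition tx : tm := tpow (Cst 2) (Times (Plus tn (Cst 1)) (Plus tn (Cst 1))).
Definition tvertex (s : tm) : tm := tif (tnot s) (Times (Cst 2) tx).
Definition tedge (s s' : tm) : tm :=
  call [:: s; s'] (Plus (tnot (Times (Var 0) (Var 1)))
    (Times (tbool (Times (Var 0) (Var 1))) (Times (Cst 2) (teq (Var 0) (Var 1))))).

Definition tvertices (k a : tm) : tm :=
  call [:: k; a] (Prod tn (tif (Times (tbag (Var 0) (Var 2)) (tnot (tkept (Var 0) (Var 2))))
    (tvertex (tspin (Var 0) (Var 1) (Var 2))))).
Definition tedges (k a : tm) : tm :=
  call [:: k; a] (Prod tn (Prod (Var 2)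
    (tif (Times (tG (Var 2) (Var 3)) (Times (tbag (Var 0) (Var 2)) (Times (tbag (Var 0) (Var 3))
           (tnot (Times (tkept (Var 0) (Var 2)) (tkept (Var 0) (Var 3)))))))
      (tedge (tspin (Var 0) (Var 1) (Var 2)) (tspin (Var 0) (Var 1) (Var 3)))))).
Definition tmessages (k a : tm) : tm :=
  call [:: k; a] (Prod tN (tif (Times (tlt (Var 0) (Var 2)) (tT (tord (Var 0)) (tord (Var 2))))
    (Rd (tcell (Var 2) (tchildcode (Var 2) (Var 0) (Var 1)))))).

(** Nodes are processed from last to first, so that children precede their parent. *)
Definition tnode (i : tm) : tm := Minus (Minus tN (Cst 1)) i.
(** Not small, hence no admissible range of [Sum]; it bounds a loop on the level of commands. *)
Definition tstates (i : tm) : tm := tpow (Cst 3) (trank (tnode i) tn).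
Definition taddress (i a : tm) : tm := tcell (tnode i) (tkeptcode (tnode i) a).
Definition tupdate (i a : tm) : tm :=
  Plus (Rd (taddress i a))
    (Times (Times (tvertices (tnode i) a) (tedges (tnode i) a)) (tmessages (tnode i) a)).

(* 1 as long as no terminator 2 has been met among the digits 0, ..., i of t. *)
Definition tunended (i : tm) : tm :=
  call [:: i] (Prod (Plus (Var 0) (Cst 1)) (tnot (Minus (tdigit (Var 1)) (Cst 1)))).
Definition tsought : tm :=
  call [::] (Sum (Plus tn (Cst 2)) (Times (tunended (Var 0)) (Times (tdigit (Var 0)) (tpow (Cst 2) (Var 0))))).
(** Without a terminator among the positions 0, ..., n + 1, t exceeds n and [tsought] may be wrong;
    the first factor is then 0. *)
Definition tguard : tm := Times (tnot (tunended (Plus tn (Cst 1)))) (tnot (Minus tsought tn)).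
(** The double difference equals t for t at most n. It makes the exponent small in the sense of
    typing, which [tsought] alone is not. *)
Definition tresult : tm :=
  tmod 2 (Quot (Quot (Rd (tcell (Cst 0) (Cst 0))) (tpow (Cst 2) tn))
    (tpow tx (Minus tn (Minus tn tsought)))).

(** * Layout of the input *)

Lemma nth_allpairs (S S' R : Type) (f : S -> S' -> R) x0 y0 z0 s s' i j :
  i < size s -> j < size s' ->
  nth z0 [seq f x y | x <- s, y <- s'] (i * size s' + j) = f (nth x0 s i) (nth y0 s' j).
Proof.
move=> + js; elim: s i => // x s IH [|i] /= is_; rewrite nth_cat size_map.
  by rewrite js (nth_map y0).
by rewrite ltnNge mulSn -addnA leq_addr /= addKn IH.
Qed.

Lemma nth_enum_pairs p q (F : 'I_p -> 'I_q -> nat) (u : 'I_p) (v : 'I_q) :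
  nth 0 [seq F u v | u <- enum 'I_p, v <- enum 'I_q] (u * q + v) = F u v.
Proof.
have := @nth_allpairs _ _ _ F u v 0 (enum 'I_p) (enum 'I_q) u v.
by rewrite !size_enum_ord !nth_ord_enum => ->.
Qed.

Lemma binary_sum t : \sum_(i < bitlen t) t %/ 2 ^ i %% 2 * 2 ^ i = t.
Proof.
suff H L a : a < 2 ^ L -> \sum_(i < L) a %/ 2 ^ i %% 2 * 2 ^ i = a by apply/H/bitlen_lt.
elim: L a => [|L IH] a; first by rewrite big_ord0; case: a.
move=> aL; rewrite big_ord_recl /= expn0 divn1 muln1.
rewrite [RHS](divn_eq a 2) addnC; congr (_ + _).
rewrite -[in RHS](IH (a %/ 2)); last by rewrite ltn_divLR // -expnSr.
rewrite big_distrl; apply: eq_bigr => i _ /=.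
by rewrite /bump /= add1n -mulnA -expnSr -divnMA -expnS.
Qed.

Definition input_base (n N : nat) : nat := 2 + n * n + N * N + N * n + (n + 2).

Section Input.
Variables (n N : nat) (G : rel 'I_n) (T : rel 'I_N) (B : 'I_N -> {set 'I_n}) (t : nat).

(** Only the cells below [input_base] are fixed, because the program writes behind them. *)
Definition holds_input (m : nat -> nat) : Prop :=
  forall a, a < input_base n N -> m a = nth 0 (encode G T B t) a.

Lemma nth_cat_shift (l l' : seq nat) k i : size l = k -> nth 0 (l ++ l') (k + i) = nth 0 l' i.
Proof. by move=> <-; rewrite nth_cat ltnNge leq_addr addKn. Qed.

Lemma nth_cat_head (l l' : seq nat) i : i < size l -> nth 0 (l ++ l') i = nth 0 l i.
Proof. by rewrite nth_cat => ->. Qed.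

Lemma ltn_pair p q (u : 'I_p) (v : 'I_q) : u * q + v < p * q.
Proof.
have up := ltn_ord u; have vq := ltn_ord v.
by apply: (@leq_trans (u.+1 * q)); [rewrite mulSn addnC ltn_add2r | rewrite leq_mul2r up orbT].
Qed.

Lemma size_enum_pairs p q (F : 'I_p -> 'I_q -> nat) :
  size [seq F u v | u <- enum 'I_p, v <- enum 'I_q] = p * q.
Proof. by rewrite size_allpairs !size_enum_ord. Qed.

Lemma nth_encode_G (u v : 'I_n) : nth 0 (encode G T B t) (2 + (u * n + v)) = G u v.
Proof.
rewrite /encode nth_cat_shift // nth_cat_head ?size_enum_pairs ?ltn_pair //.
exact: (nth_enum_pairs (fun u v => nat_of_bool (G u v))).
Qed.

Lemma nth_encode_T (x y : 'I_N) :
  nth 0 (encode G T B t) (2 + n * n + (x * N + y)) = T x y.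
Proof.
rewrite /encode -addnA nth_cat_shift // nth_cat_shift ?size_enum_pairs //.
rewrite nth_cat_head ?size_enum_pairs ?ltn_pair //.
exact: (nth_enum_pairs (fun u v => nat_of_bool (T u v))).
Qed.

Lemma nth_encode_B (x : 'I_N) (v : 'I_n) :
  nth 0 (encode G T B t) (2 + n * n + N * N + (x * n + v)) = (v \in B x).
Proof.
rewrite /encode -!addnA nth_cat_shift // nth_cat_shift ?size_enum_pairs //.
rewrite nth_cat_shift ?size_enum_pairs // nth_cat_head ?size_enum_pairs ?ltn_pair //.
exact: (nth_enum_pairs (fun x v => nat_of_bool (v \in B x))).
Qed.

Lemma nth_encode_t i :
  nth 0 (encode G T B t) (2 + n * n + N * N + N * n + i) = nth 0 (rcons (binary t) 2) i.
Proof.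
rewrite /encode -!addnA nth_cat_shift // nth_cat_shift ?size_enum_pairs //.
by rewrite nth_cat_shift ?size_enum_pairs // nth_cat_shift ?size_enum_pairs.
Qed.

Lemma size_encode : size (encode G T B t) = 2 + n * n + N * N + N * n + (bitlen t).+1.
Proof.
by rewrite /encode !size_cat !size_enum_pairs size_rcons size_map size_iota !addnA.
Qed.

Lemma encode_bound a : nth 0 (encode G T B t) a <= n + N + 2.
Proof.
have [sa|sa] := ltnP a (size (encode G T B t)); last by rewrite nth_default.
move: (mem_nth 0 sa); move: (nth _ _ _) => z; rewrite /encode inE => /orP[/eqP->|]; first lia.
rewrite inE => /orP[/eqP->|]; first lia.
rewrite !mem_cat => /or4P[/allpairsP[p [_ _ ->]]|/allpairsP[p [_ _ ->]]|/allpairsP[p [_ _ ->]]|].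
- by case: (G _ _); lia.
- by case: (T _ _); lia.
- by case: (_ \in _); lia.
rewrite mem_rcons inE => /orP[/eqP->|/mapP[i _ ->]]; first lia.
have : t %/ 2 ^ i %% 2 < 2 by rewrite ltn_mod.
lia.
Qed.

Section Memory.
Variables (m : nat -> nat) (r : seq nat).
Hypothesis m_input : holds_input m.

Lemma mem_n : m 0 = n.
Proof. by rewrite m_input //; rewrite /input_base; lia. Qed.

Lemma mem_N : m 1 = N.
Proof. by rewrite m_input //; rewrite /input_base; lia. Qed.

Lemma den_n : den r m tn = n. Proof. exact: mem_n. Qed.
Lemma den_N : den r m tN = N. Proof. exact: mem_N. Qed.

Lemma den_G a b (u v : 'I_n) : den r m a = u -> den r m b = v -> den r m (tG a b) = G u v.
Proof.
move=> ua vb; rewrite den_bool /= mem_n ua vb m_input.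
  by rewrite nth_encode_G; case: (G u v).
rewrite /input_base; have := ltn_pair u v; lia.
Qed.

Lemma den_T a b (x y : 'I_N) : den r m a = x -> den r m b = y -> den r m (tT a b) = T x y.
Proof.
move=> xa yb; rewrite den_bool /= mem_n mem_N xa yb m_input.
  by rewrite nth_encode_T; case: (T x y).
rewrite /input_base; have := ltn_pair x y; lia.
Qed.

Lemma den_B a b (x : 'I_N) (v : 'I_n) : den r m a = x -> den r m b = v ->
  den r m (tB a b) = (v \in B x).
Proof.
move=> xa vb; rewrite den_bool /= mem_n mem_N xa vb m_input.
  by rewrite nth_encode_B; case: (v \in B x).
rewrite /input_base; have := ltn_pair x v; lia.
Qed.

Lemma den_digit a : den r m a < n + 2 ->
  den r m (tdigit a) = nth 0 (rcons (binary t) 2) (den r m a).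
Proof.
move=> an; rewrite /= mem_n mem_N m_input; first exact: nth_encode_t.
by rewrite /input_base ltn_add2l.
Qed.

Lemma den_base : den r m tbase = input_base n N.
Proof. by rewrite /= mem_n mem_N. Qed.

Lemma den_x : den r m tx = 2 ^ (n.+1 * n.+1).
Proof. by rewrite /tx den_pow /= mem_n !addn1. Qed.

End Memory.

End Input.

Lemma den_not0 r m a : den r m (tnot a) = (den r m a == 0).
Proof. by rewrite /=; case: (den r m a). Qed.

Lemma sum_bool_neq0 k (P : nat -> bool) :
  (\sum_(j < k) P j != 0) = [exists j : 'I_k, P j].
Proof.
rewrite sum_nat_eq0 negb_forall; apply: eq_existsb => j /=.
by case: (P j).
Qed.

Section Guard.
Variables (n N : nat) (G : rel 'I_n) (T : rel 'I_N) (B : 'I_N -> {set 'I_n}) (t : nat).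
Variables (m : nat -> nat).
Hypothesis m_input : holds_input G T B t m.

Lemma den_unended r a : den r m a < n + 2 ->
  den r m (tunended a) = (den r m a < bitlen t).
Proof.
move=> an; rewrite /tunended den_call [map _ _]/=.
move: (den r m a) an => i iN.
change (\prod_(j < i + 1) den [:: i; nat_of_ord j] m (tnot (Minus (tdigit (Var 1)) (Cst 1)))
  = (i < bitlen t)).
(* Only the terminator 2 exceeds 1: the digits before it are 0 or 1, and positions behind it read as
   0. *)
transitivity (\prod_(j < i + 1) (j != bitlen t :> nat) : nat).
  apply: eq_bigr => j _.
  have ji : j < n + 2 by move: (ltn_ord j) => /=; lia.
  rewrite den_not0.
  change ((den [:: i;
    nat_of_ord j] m (tdigit (Var 1)) - 1 == 0 : nat) = (j != bitlen t :> nat)).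
  rewrite (den_digit m_input) // [den _ _ (Var 1)]/= nth_rcons size_map size_iota.
  case: ltngtP => jt //; rewrite (nth_map 0) ?size_iota //.
  have : t %/ 2 ^ nth 0 (iota 0 (bitlen t)) j %% 2 < 2 by rewrite ltn_mod.
  by case: (_ %% 2) => [|[|]].
case: ltnP => ti.
  rewrite big1 // => j _; have ji := ltn_ord j.
  by have /negbTE -> : nat_of_ord j != bitlen t by lia.
have tiS : bitlen t < i + 1 by lia.
by rewrite (bigD1 (Ordinal tiS)) //= eqxx.
Qed.

Lemma den_sought r : bitlen t <= n + 2 -> den r m tsought = t.
Proof.
move=> tn; rewrite /tsought den_call.
change (\sum_(i < m 0 + 2) den [:: nat_of_ord i] m (Times (tunended (Var 0))
   (Times (tdigit (Var 0)) (tpow (Cst 2) (Var 0)))) = t).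
rewrite (mem_n m_input) -[RHS]binary_sum (big_ord_widen _ (fun i => t %/ 2 ^ i %% 2 * 2 ^ i) tn).
rewrite [RHS]big_mkcond; apply: eq_bigr => i _.
change (den [:: nat_of_ord i] m (tunended (Var 0)) * (den [:: nat_of_ord i] m (tdigit (Var 0))
  * den [:: nat_of_ord i] m (tpow (Cst 2) (Var 0))) = if i < bitlen t then t %/ 2 ^ i %% 2 * 2 ^ i else 0).
have iv : den [:: nat_of_ord i] m (Var 0) < n + 2 := ltn_ord i.
rewrite den_unended // (den_digit m_input) // den_pow ![den _ _ (Var 0)]/= [den _ _ (Cst 2)]/=.
case: ifP => it; rewrite ?mul0n // mul1n nth_rcons size_map size_iota it.
by rewrite (nth_map 0) ?size_iota // nth_iota.
Qed.

Lemma den_guard : den [::] m tguard = (t <= n).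
Proof.
change (den [::] m (tnot (tunended (Plus tn (Cst 1)))) * den [::] m (tnot (Minus tsought tn))
  = (t <= n)).
have nS : den [::] m (Plus tn (Cst 1)) = n + 1 by rewrite /= (mem_n m_input).
rewrite !den_not0 den_unended nS ?addn1 ?addn2 //.
case: ltnP => tb.
  rewrite mul0n; case: leqP => // tn; have := bitlen_leS t; lia.
have ts : den [::] m tsought = t by apply: den_sought; lia.
change (1 * (den [::] m tsought - m 0 == 0) = (t <= n)).
by rewrite mul1n ts (mem_n m_input).
Qed.
End Guard.

(** * Search for the next node *)

Section Next.
Variables (n N : nat) (G : rel 'I_n) (T : rel 'I_N) (B : 'I_N -> {set 'I_n}) (t : nat).
Variables (m : nat -> nat) (k : nat) (xs : nat -> 'I_N).
Hypothesis m_input : holds_input G T B t m.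
Hypothesis m_xs : forall j, j < k -> m (input_base n N + j) = xs j.

Lemma den_ord r a : den r m a < k -> den r m (tord a) = xs (den r m a).
Proof. by move=> ak; rewrite -m_xs // -(den_base r m_input). Qed.

Definition candidate (y : 'I_N) : bool :=
  [forall j : 'I_k, xs j != y] && ((k == 0) || [exists j : 'I_k, T (xs j) y]).

Lemma den_cand r a b (y : 'I_N) : den r m a = k -> den r m b = y ->
  den r m (tcand a b) = candidate y.
Proof.
move=> ak bY; rewrite (@den_and r m _ _ [forall j : 'I_k, xs j != y]
  ((k == 0) || [exists j : 'I_k, T (xs j) y])) //.
  rewrite den_not0 den_call [map _ _]/= ak bY.
  change (nat_of_bool ((\sum_(j < k) den [:: k; nat_of_ord y; nat_of_ord j] m
    (teq (tord (Var 2)) (Var 1))) == 0) = [forall j : 'I_k, xs j != y]).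
  have -> : \sum_(j < k) den [:: k; nat_of_ord y; nat_of_ord j] m (teq (tord (Var 2)) (Var 1))
    = \sum_(j < k) (xs j == y).
    apply: eq_bigr => j _; rewrite den_eq den_ord; last exact: ltn_ord.
    by rewrite -val_eqE.
  rewrite -[_ == 0]negbK (sum_bool_neq0 k (fun j => xs j == y)) negb_exists.
  by congr nat_of_bool; apply: eq_forallb => j.
rewrite den_bool; congr nat_of_bool.
change (den r m (tnot a) + den r m (call [:: a;
  b] (Sum (Var 0) (tT (tord (Var 2)) (Var 1)))) != 0
  = (k == 0) || [exists j : 'I_k, T (xs j) y]).
rewrite den_not0 ak den_call [map _ _]/= ak bY.
change ((k == 0 : nat) + (\sum_(j < k) den [:: k; nat_of_ord y; nat_of_ord j] m
    (tT (tord (Var 2)) (Var 1))) != 0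
  = (k == 0) || [exists j : 'I_k, T (xs j) y]).
have -> : \sum_(j < k) den [:: k; nat_of_ord y; nat_of_ord j] m (tT (tord (Var 2)) (Var 1))
    = \sum_(j < k) T (xs j) y.
  apply: eq_bigr => j _; apply: (den_T m_input) => //.
  exact: (@den_ord [:: k; nat_of_ord y; nat_of_ord j] (Var 2) (ltn_ord j)).
by rewrite addn_eq0 negb_and (sum_bool_neq0 k (fun j => T (xs j) y)) eqb0 negbK.
Qed.

Hypothesis T_tree : tree T.
Hypothesis kN : k < N.

(** Fewer than [N] nodes are placed, so some node is left, and by connectedness an edge leaves the
    set of placed nodes. *)
Lemma candidate_exists : exists y, candidate y.
Proof.
case: T_tree => _ _ Tc; case: (posnP k) => k0.
  exists (Ordinal kN); apply/andP; split; last by apply/orP; left; apply/eqP.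
  by apply/forallP => -[j jk]; exfalso; rewrite k0 in jk.
pose A : {set 'I_N} := [set xs j | j : 'I_k].
have Ak : #|A| <= k by rewrite -[X in _ <= X]card_ord leq_imset_card.
have [y yA] : exists y, y \notin A.
  apply/existsP; rewrite -negb_forall; apply/negP => /forallP H.
  have : A = setT by apply/setP => z; rewrite H inE.
  by move=> AT; move: Ak; rewrite AT cardsT card_ord leqNgt kN.
have xA : xs 0 \in A by apply/imsetP; exists (Ordinal k0).
have [u [v [uv uA vA]]] := connect_exit (Tc (xs 0) y) xA yA.
exists v; apply/andP; split.
  by apply/forallP => j; apply: contraNneq vA => <-; apply/imsetP; exists j.
have [j _ uE] := imsetP uA; apply/orP; right; apply/existsP; exists j.
by rewrite -uE.
Qed.

Lemma den_next : exists2 y : 'I_N, den [:: k] m (tnext (Var 0)) = y & candidate y.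
Proof.
pose c (z : nat) := if (insub z : option 'I_N) is Some y then candidate y else false.
have cE (y : 'I_N) : c y = candidate y by rewrite /c valK.
have [|iN ci] := @first_index c N.
  by have [y cy] := candidate_exists; exists y; rewrite ?ltn_ord ?cE.
move: iN ci; set i := \sum_(y < N) _ => iN; rewrite (cE (Ordinal iN)) => ci.
exists (Ordinal iN) => //; rewrite /tnext den_call [map _ _]/= .
change (\sum_(y < m 1) \prod_(z < y + 1) den [:: k; nat_of_ord y; nat_of_ord z] m
  (tnot (tcand (Var 0) (Var 2))) = i).
rewrite (mem_N m_input); apply: eq_bigr => y _; rewrite addn1; apply: eq_bigr => z _.
have zN : z < N by have := ltn_ord z; have := ltn_ord y; lia.
apply: den_not; rewrite (cE (Ordinal zN)); exact: den_cand.
Qed.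

End Next.

(** * Values of the terms *)

Local Notation memory := (nat -> nat).

Fixpoint steps (f : nat -> memory -> memory) (m : memory) (i : nat) : memory :=
  if i is i'.+1 then f i' (steps f m i') else m.

Definition order_step (k : nat) (m : memory) : memory :=
  upd m (den [:: k] m (Plus tbase (Var 0))) (den [:: k] m (tnext (Var 0))).

(** The order is whatever the search finds; injectivity and earlier neighbours are all that the
    elimination relies on. *)
Lemma order_phase n N (G : rel 'I_n) (T : rel 'I_N) (B : 'I_N -> {set 'I_n}) t m0 :
  holds_input G T B t m0 -> tree T ->
  exists xs : nat -> 'I_N, [/\
    forall k a, k <= N -> steps order_step m0 k a =
      if input_base n N <= a < input_base n N + k then xs (a - input_base n N) : nat
      else m0 a,
    forall j k, j < N -> k < N -> xs j = xs k -> j = k &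
    forall k, 0 < k < N -> exists2 j, j < k & T (xs j) (xs k)].
Proof.
move=> in0 Ttree; have [N0 _ _] := Ttree; rewrite card_ord in N0.
pose mu := steps order_step m0.
(* For [k < N] the default is never taken, since [den_next] provides a value below [N]. *)
pose xs k : 'I_N := insubd (Ordinal N0) (den [:: k] (mu k) (tnext (Var 0))).
have base_lt a k : a < input_base n N ->
    (input_base n N <= a < input_base n N + k) = false by lia.
have H k : k <= N -> (forall a, mu k a = if input_base n N <= a < input_base n N + k
    then xs (a - input_base n N) : nat else m0 a)
  /\ (forall j, j < k -> candidate T j xs (xs j)).
  elim: k => [|k IH] kN; first by split=> // a; rewrite addn0; case: ifP => //; lia.
  have [mE cE] := IH (ltnW kN).
  have mi : holds_input G T B t (mu k) by move=> a ab; rewrite mE base_lt ?in0.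
  have mx j : j < k -> mu k (input_base n N + j) = xs j.
    by move=> jk; rewrite mE leq_addr ltn_add2l jk addKn.
  have [y yE cy] := den_next mi mx Ttree kN.
  have xk : xs k = y by apply: val_inj; rewrite /xs yE val_insubd ltn_ord.
  have bE : den [:: k] (mu k) (Plus tbase (Var 0)) = input_base n N + k.
    by rewrite -(den_base [:: k] mi).
  split=> [a|j]; last by rewrite ltnS leq_eqVlt => /orP[/eqP->|/cE //]; rewrite xk.
  change (upd (mu k) (den [:: k] (mu k) (Plus tbase (Var 0))) (den [:: k] (mu k) (tnext (Var 0))) a =
    if input_base n N <= a < input_base n N + k.+1 then xs (a - input_base n N) : nat else m0 a).
  rewrite bE yE -xk /upd mE; case: eqP => [->|ne].
    by rewrite leq_addr ltn_add2l ltnSn addKn.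
  by congr (if _ then _ else _); lia.
have cand j k : j < k -> k < N -> xs j != xs k.
  by move=> jk kN; have [_ /(_ k kN)/andP[/forallP/(_ (Ordinal jk))]] := H N (leqnn N).
exists xs; split.
- by move=> k a /H[].
- move=> j k jN kN E; case: (ltngtP j k) => // jk.
    by have := cand _ _ jk kN; rewrite E eqxx.
  by have := cand _ _ jk jN; rewrite E eqxx.
- move=> k /andP[k0 kN]; have [_ /(_ k kN)/andP[_]] := H N (leqnn N).
  by case: eqP => [k00|_ /= /existsP[j Tj]]; [rewrite k00 in k0|exists j].
Qed.

Definition rank n (K : {set 'I_n}) (v : nat) : nat := #|[set u in K | u < v]|.

Definition decode n (K : {set 'I_n}) (a : nat) : spins n :=
  [ffun v : 'I_n => if v \in K then inord (a %/ 3 ^ rank K v %% 3) else ord0].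

Definition code n (s : spins n) : nat := \sum_v s v * 3 ^ v.

Section Values.
Variables (n N : nat) (G : rel 'I_n) (T : rel 'I_N) (B : 'I_N -> {set 'I_n}) (t : nat).
Variables (m : memory) (xs : nat -> 'I_N).
Hypothesis m_input : holds_input G T B t m.
Hypothesis m_xs : forall j, j < N -> m (input_base n N + j) = xs j.

Let b k := B (xs k).

Lemma den_bag r x y k (v : 'I_n) : k < N -> den r m x = k -> den r m y = v ->
  den r m (tbag x y) = (v \in b k).
Proof.
move=> kN xk yv; apply: (den_B m_input) => //.
by rewrite (den_ord m_input m_xs) xk.
Qed.

Lemma sum_rank (K : {set 'I_n}) (P : nat -> bool) v : v <= n ->
  (forall u : 'I_n, u < v -> P u = (u \in K)) -> \sum_(u < v) P u = rank K v.
Proof.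
move=> vn PK; rewrite (big_ord_widen _ (fun u => P u : nat) vn) /rank -sum1_card.
rewrite big_mkcond [RHS]big_mkcond; apply: eq_bigr => u _; rewrite inE.
by case: ltnP => uv; rewrite ?andbF // PK // andbT; case: (u \in K).
Qed.

Lemma den_rank r x y k v : k < N -> v <= n -> den r m x = k -> den r m y = v ->
  den r m (trank x y) = rank (b k) v.
Proof.
move=> kN vn xk yv; rewrite /trank den_call [map _ _]/= xk yv.
change (\sum_(u < v) den [:: k; v; nat_of_ord u] m (tbag (Var 0) (Var 2)) = rank (b k) v).
rewrite -(@sum_rank (b k) (fun u => if insub u is Some u' then (u' : 'I_n) \in b k else false)) //.
  apply: eq_bigr => u _; have un : u < n := leq_trans (ltn_ord u) vn.
  rewrite insubT; exact: (@den_bag [:: k; v; nat_of_ord u] (Var 0) (Var 2) k (Ordinal un)).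
by move=> u _; rewrite valK.
Qed.

Lemma den_kept r x y k (v : 'I_n) : k < N -> den r m x = k -> den r m y = v ->
  den r m (tkept x y) = (v \in upto b k).
Proof.
move=> kN xk yv; rewrite den_bool den_call [map _ _]/= xk yv; congr nat_of_bool.
transitivity ((\sum_(j < k) (v \in b j)) != 0).
  congr (_ != 0); change (\sum_(j < k) den [:: k; nat_of_ord v;
    nat_of_ord j] m (tbag (Var 2) (Var 1)) = \sum_(j < k) (v \in b j)).
  apply: eq_bigr => j _; apply: (@den_bag _ (Var 2) (Var 1)) => //; exact: ltn_trans kN.
rewrite (sum_bool_neq0 k (fun j => v \in b j)).
by apply/existsP/uptoP => [[j vj]|[j jk vj]]; [exists j | exists (Ordinal jk)].
Qed.

Lemma den_spin r x y z k a (v : 'I_n) : k < N -> den r m x = k -> den r m y = a ->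
  den r m z = v -> den r m (tspin x y z) = decode (b k) a v.
Proof.
move=> kN xk ya zv.
change (den r m (tbag x z) * den r m (tmod 3 (Quot y (tpow (Cst 3) (trank x z)))) = decode (b k) a v).
rewrite (den_bag kN xk zv) den_mod ffunE.
change ((v \in b k) * ((den r m y %/ den r m (tpow (Cst 3) (trank x z))) %% 3) =
  (if v \in b k then inord (a %/ 3 ^ rank (b k) v %% 3) else ord0 : 'I_3)).
rewrite den_pow (den_rank kN (ltnW (ltn_ord v)) xk zv) ya.
by case: (v \in b k); rewrite ?mul0n // mul1n inordK // ltn_mod.
Qed.

Lemma den_keptcode r x y k a : k < N -> den r m x = k -> den r m y = a ->
  den r m (tkeptcode x y) = code (srestr (upto b k) (decode (b k) a)).
Proof.
move=> kN xk ya; rewrite /tkeptcode den_call [map _ _]/= xk ya.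
change (\sum_(v < m 0) den [:: k; a; nat_of_ord v] m (tkept (Var 0) (Var 2))
   * den [:: k; a; nat_of_ord v] m (tspin (Var 0) (Var 1) (Var 2))
   * den [:: k; a;
     nat_of_ord v] m (tpow (Cst 3) (Var 2)) = code (srestr (upto b k) (decode (b k) a))).
rewrite (mem_n m_input); apply: eq_bigr => v _.
rewrite den_pow (@den_kept _ _ _ k v) // (@den_spin _ _ _ _ k a v) // [srestr _ _ _]ffunE.
by case: ifP => _; rewrite ?mul1n ?mul0n.
Qed.

Lemma den_childcode r x y z j k a : j < N -> k < N ->
  den r m x = j -> den r m y = k -> den r m z = a ->
  den r m (tchildcode x y z) = code (srestr (b j) (decode (b k) a)).
Proof.
move=> jN kN xj yk za; rewrite /tchildcode den_call [map _ _]/= xj yk za.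
change (\sum_(v < m 0) den [:: j; k; a; nat_of_ord v] m (tbag (Var 0) (Var 3))
   * den [:: j; k; a; nat_of_ord v] m (tspin (Var 1) (Var 2) (Var 3))
   * den [:: j; k; a;
     nat_of_ord v] m (tpow (Cst 3) (Var 3)) = code (srestr (b j) (decode (b k) a))).
rewrite (mem_n m_input); apply: eq_bigr => v _.
rewrite den_pow (@den_bag _ _ _ j v) // (@den_spin _ _ _ _ k a v) // [srestr _ _ _]ffunE.
by case: ifP => _; rewrite ?mul1n ?mul0n.
Qed.

Definition cell (k c : nat) : nat := input_base n N + N + (c * N + k).

Lemma den_cell r x y k c : den r m x = k -> den r m y = c ->
  den r m (tcell x y) = cell k c.
Proof.
move=> xk yc.
change (den r m tbase + m 1 + (den r m y * m 1 + den r m x) = cell k c).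
by rewrite (den_base r m_input) (mem_N m_input) xk yc.
Qed.

Let x := 2 ^ (n.+1 * n.+1).

Lemma den_vertex r y (s : 'I_3) : den r m y = s ->
  den r m (tvertex y) = vertex_weight x s.
Proof.
move=> ys; rewrite /tvertex (den_if _ (den_not0 _ _ _)) ys /vertex_weight -val_eqE /=.
by case: ifP => // _; rewrite -[X in 2 * X]/(den r m tx) (den_x r m_input).
Qed.

Lemma den_edge r y z (s s' : 'I_3) : den r m y = s -> den r m z = s' ->
  den r m (tedge y z) = edge_weight s s'.
Proof.
move=> ys zs; rewrite /tedge den_call [map _ _]/= ys zs.
change (den [:: s : nat; s' : nat] m (tnot (Times (Var 0) (Var 1)))
  + den [:: s : nat; s' : nat] m (tbool (Times (Var 0) (Var 1)))
    * (2 * den [:: s : nat; s' : nat] m (teq (Var 0) (Var 1))) = edge_weight s s').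
rewrite den_not0 den_bool den_eq /= muln_eq0 /edge_weight -!val_eqE /=.
by case: (s == 0 :> nat); case: (s' == 0 :> nat); case: (s == s' :> nat).
Qed.

Lemma den_vertices r y z k a : k < N -> den r m y = k -> den r m z = a ->
  den r m (tvertices y z) =
  \prod_v (if new_vertex b k v then vertex_weight x (decode (b k) a v) else 1).
Proof.
move=> kN yk za; rewrite /tvertices den_call [map _ _]/= yk za.
change (\prod_(v < m 0) den [:: k; a; nat_of_ord v] m
  (tif (Times (tbag (Var 0) (Var 2)) (tnot (tkept (Var 0) (Var 2))))
    (tvertex (tspin (Var 0) (Var 1) (Var 2)))) =
  \prod_v (if new_vertex b k v then vertex_weight x (decode (b k) a v) else 1)).
rewrite (mem_n m_input); apply: eq_bigr => v _.
rewrite (den_if _ (den_and (@den_bag _ _ _ k v _ _ _) (den_not (@den_kept _ _ _ k v _ _ _)))) //.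
by rewrite (den_vertex (@den_spin _ _ _ _ k a v _ _ _ _)).
Qed.

Lemma den_edges r y z k a : k < N -> den r m y = k -> den r m z = a ->
  den r m (tedges y z) =
  \prod_(u : 'I_n) \prod_(v : 'I_n | v < u) (if new_edge b G k u v
     then edge_weight (decode (b k) a u) (decode (b k) a v) else 1).
Proof.
move=> kN yk za; rewrite /tedges den_call [map _ _]/= yk za.
pose f := tif (Times (tG (Var 2) (Var 3)) (Times (tbag (Var 0) (Var 2)) (Times (tbag (Var 0) (Var 3))
           (tnot (Times (tkept (Var 0) (Var 2)) (tkept (Var 0) (Var 3)))))))
      (tedge (tspin (Var 0) (Var 1) (Var 2)) (tspin (Var 0) (Var 1) (Var 3))).
change (\prod_(u < m 0) \prod_(v < u) den [:: k; a; nat_of_ord u; nat_of_ord v] m f =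
  \prod_(u : 'I_n) \prod_(v : 'I_n | v < u) (if new_edge b G k u v
     then edge_weight (decode (b k) a u) (decode (b k) a v) else 1)).
rewrite (mem_n m_input); apply: eq_bigr => u _.
rewrite (big_ord_widen _ (fun v => den [:: k; a; nat_of_ord u; v] m f) (ltnW (ltn_ord u))).
apply: eq_bigr => v _; rewrite /f.
rewrite (den_if _ (den_and (@den_G _ _ _ _ _ _ _ _ m_input _ _ u v _ _)
  (den_and (@den_bag _ _ _ k u _ _ _) (den_and (@den_bag _ _ _ k v _ _ _)
  (den_not (den_and (@den_kept _ _ _ k u _ _ _) (@den_kept _ _ _ k v _ _ _))))))) //.
by rewrite (den_edge (@den_spin _ _ _ _ k a u _ _ _ _) (@den_spin _ _ _ _ k a v _ _ _ _)).
Qed.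

Lemma den_messages r y z k a : k < N -> den r m y = k -> den r m z = a ->
  den r m (tmessages y z) =
  \prod_(j < N) (if (k < j) && T (xs k) (xs j)
     then m (cell j (code (srestr (b j) (decode (b k) a)))) else 1).
Proof.
move=> kN yk za; rewrite /tmessages den_call [map _ _]/= yk za.
change (\prod_(j < m 1) den [:: k; a; nat_of_ord j] m
  (tif (Times (tlt (Var 0) (Var 2)) (tT (tord (Var 0)) (tord (Var 2))))
    (Rd (tcell (Var 2) (tchildcode (Var 2) (Var 0) (Var 1))))) =
  \prod_(j < N) (if (k < j) && T (xs k) (xs j)
     then m (cell j (code (srestr (b j) (decode (b k) a)))) else 1)).
rewrite (mem_N m_input); apply: eq_bigr => j _.
rewrite (den_if _ (den_and (den_lt _ _ _ _) (@den_T _ _ _ _ _ _ _ _ m_input _ _ (xs k) (xs j) _ _))).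
- congr (if _ then _ else _).
  change (m (den [:: k; a; nat_of_ord j] m (tcell (Var 2) (tchildcode (Var 2) (Var 0) (Var 1))))
    = m (cell j (code (srestr (b j) (decode (b k) a))))).
  by congr (m _); apply: den_cell => //; apply: den_childcode.
- exact: (den_ord m_input m_xs (r := [:: k; a; nat_of_ord j]) (a := Var 0) kN).
- exact: (den_ord m_input m_xs (r := [:: k; a; nat_of_ord j]) (a := Var 2) (ltn_ord j)).
Qed.

Lemma den_node r y i : den r m y = i -> den r m (tnode y) = N - 1 - i.
Proof. by move=> /= ->; rewrite (mem_N m_input). Qed.

Lemma den_states r y i : i < N -> den r m y = i ->
  den r m (tstates y) = 3 ^ #|b (N - 1 - i)|.
Proof.
move=> iN yi;
  rewrite /tstates den_pow (@den_rank _ _ _ (N - 1 - i) n) ?(den_n _ m_input) ?(den_node yi) //; last by lia.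
by congr (_ ^ _); apply: eq_card => v; rewrite inE ltn_ord andbT.
Qed.

Definition address k a := cell k (code (srestr (upto b k) (decode (b k) a))).

Definition summand k a :=
  local b G (vertex_weight x) edge_weight k (decode (b k) a)
  * \prod_(j < N) (if (k < j) && T (xs k) (xs j)
     then m (cell j (code (srestr (b j) (decode (b k) a)))) else 1).

Lemma den_address r y z i a : i < N -> den r m y = i -> den r m z = a ->
  den r m (taddress y z) = address (N - 1 - i) a.
Proof.
move=> iN yi za; apply: den_cell; first exact: den_node.
by apply: den_keptcode => //; [lia | exact: den_node].
Qed.

Lemma den_update r y z i a : i < N -> den r m y = i -> den r m z = a ->
  den r m (tupdate y z) = m (address (N - 1 - i) a) + summand (N - 1 - i) a.
Proof.
move=> iN yi za; have kN : N - 1 - i < N by lia.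
change (m (den r m (taddress y z)) + den r m (tvertices (tnode y) z)
  * den r m (tedges (tnode y) z) * den r m (tmessages (tnode y) z)
  = m (address (N - 1 - i) a) + summand (N - 1 - i) a).
rewrite (den_address iN yi za) (den_vertices kN (den_node yi) za).
by rewrite (den_edges kN (den_node yi) za) (den_messages kN (den_node yi) za).
Qed.

Lemma den_result r : t <= n ->
  den r m tresult = (m (cell 0 0) %/ 2 ^ n %/ x ^ t) %% 2.
Proof.
move=> le_tn; rewrite /tresult den_mod.
change ((m (den r m (tcell (Cst 0) (Cst 0))) %/ den r m (tpow (Cst 2) tn)
   %/ den r m (tpow tx (Minus tn (Minus tn tsought)))) %% 2
  = (m (cell 0 0) %/ 2 ^ n %/ x ^ t) %% 2).
rewrite (@den_cell _ _ _ 0 0) // (den_pow _ _ (Cst 2) tn) (den_pow _ _ tx) (den_x r m_input) (den_n r m_input).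
change ((m (cell 0 0) %/ 2 ^ n %/ x ^ (m 0 - (m 0 - den r m tsought))) %% 2
  = (m (cell 0 0) %/ 2 ^ n %/ x ^ t) %% 2).
rewrite (den_sought m_input); last by have := bitlen_leS t; lia.
by rewrite (mem_n m_input) subKn.
Qed.

End Values.

(** * Memory contents after message passing *)

Lemma ternary_inj k a a' : a < 3 ^ k -> a' < 3 ^ k ->
  (forall i, i < k -> a %/ 3 ^ i %% 3 = a' %/ 3 ^ i %% 3) -> a = a'.
Proof.
elim: k a a' => [|k IH] a a'; first by rewrite !ltnS !leqn0 => /eqP-> /eqP->.
move=> ak ak' H; rewrite (divn_eq a 3) (divn_eq a' 3).
have := H 0 isT; rewrite expn0 !divn1 => ->; congr (_ * _ + _).
apply: IH; rewrite ?ltn_divLR // -?expnSr // => i ik.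
by rewrite -!divnMA -expnS; apply: H.
Qed.

Lemma digit_sum (d : nat -> nat) n u : (forall i, d i < 3) -> u < n ->
  (\sum_(v < n) d v * 3 ^ v) %/ 3 ^ u %% 3 = d u.
Proof.
elim: u d n => [|u IH] d [|n] // d3 un; rewrite big_ord_recl expn0 muln1.
  rewrite divn1; have -> : \sum_(i < n) d (lift ord0 i) * 3 ^ lift ord0 i
    = (\sum_(i < n) d i.+1 * 3 ^ i) * 3.
    by rewrite big_distrl; apply: eq_bigr => i _; rewrite /= /bump add1n expnSr mulnA.
  by rewrite addnC modnMDl modn_small.
have -> : \sum_(i < n) d (lift ord0 i) * 3 ^ lift ord0 i
    = (\sum_(i < n) d i.+1 * 3 ^ i) * 3.
  by rewrite big_distrl; apply: eq_bigr => i _; rewrite /= /bump add1n expnSr mulnA.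
rewrite expnS divnMA addnC divnMDl // (divn_small (d3 0)) addn0.
exact: (IH (fun i => d i.+1)).
Qed.

Lemma code_inj n : injective (@code n).
Proof.
move=> s s' E; apply/ffunP => v; apply: val_inj.
pose d (s : spins n) i := if insub i is Some v then nat_of_ord (s (v : 'I_n)) else 0.
have dE (r : spins n) (w : 'I_n) : d r w = r w by rewrite /d valK.
have d3 r i : d r i < 3 by rewrite /d; case: insubP => // w _ _; apply: ltn_ord.
have cE r : code r = \sum_(w < n) d r w * 3 ^ w by apply: eq_bigr => w _; rewrite dE.
rewrite /= -(dE s) -(dE s') -(digit_sum (d3 s) (ltn_ord v)) -(digit_sum (d3 s') (ltn_ord v)).
by rewrite -!cE E.
Qed.

(** A discrete intermediate value argument: the rank climbs from 0 to [#|K|] in steps of 0 or 1, and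
    by 1 exactly at elements of [K]. *)
Lemma rank_surj n (K : {set 'I_n}) i : i < #|K| -> exists2 v, v \in K & rank K v = i.
Proof.
have rS (v : 'I_n) : rank K v.+1 = rank K v + (v \in K).
  rewrite /rank addnC -[X in X + _](_ : #|[set u in K | u == v]| = _); last first.
    case: (boolP (v \in K)) => vK.
      by apply/eqP/cards1P; exists v; apply/setP => u; rewrite !inE; case: eqP => [->|];
        rewrite ?vK ?andbF.
    apply/eqP; rewrite cards_eq0; apply/eqP/setP => u; rewrite !inE.
    by case: eqP => [->|]; rewrite ?andbF // (negbTE vK).
  rewrite -cardsUI addnC [X in X + _](_ : _ = 0).
    apply: eq_card => u; rewrite !inE ltnS leq_eqVlt -val_eqE.
    by case: (u \in K).
  apply/eqP; rewrite cards_eq0; apply/eqP/setP => u; rewrite !inE.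
  by case: (eqVneq u v) => [->|]; rewrite ?ltnn ?andbF.
suff H V : V <= n -> i < rank K V -> exists2 v, v \in K & rank K v = i.
  move=> iK; apply: (H n) => //; apply: leq_trans iK _.
  by rewrite subset_leq_card //; apply/subsetP => u uK; rewrite inE uK ltn_ord.
elim: V => [|V IH] Vn.
  rewrite /rank (_ : [set u in K | u < 0] = set0) ?cards0 //.
  by apply/setP => u; rewrite !inE ltn0 andbF.
rewrite (rS (Ordinal Vn)); case: (ltnP i (rank K V)) => [iV _|]; first exact: IH (ltnW Vn) iV.
rewrite /=; case: (boolP (_ \in K)) => vK Vi; rewrite ?addn0 ?addn1; last by rewrite ltnNge Vi.
by rewrite ltnS => iV; exists (Ordinal Vn) => //; apply/eqP; rewrite eqn_leq Vi iV.
Qed.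

(** [decode K] is injective because every ternary digit is the spin of some vertex, by [rank_surj];
    counting makes it onto the assignments supported on [K]. *)
Lemma sum_decode n (K : {set 'I_n}) (F : spins n -> nat) :
  \sum_(a < 3 ^ #|K|) F (decode K a) = \sum_(s | srestr K s == s) F s.
Proof.
pose d (a : 'I_(3 ^ #|K|)) := decode K a.
have d_inj : injective d.
  move=> a a' E; apply: val_inj; apply: (ternary_inj (ltn_ord a) (ltn_ord a')) => i iK.
  have [v vK <-] := rank_surj iK.
  move/ffunP: E => /(_ v)/(congr1 val); rewrite !ffunE vK /= !inordK // ltn_mod //.
have dS : d @: setT = [set s | srestr K s == s].
  apply/eqP; rewrite eqEcard; apply/andP; split.
    apply/subsetP => _ /imsetP[a _ ->]; rewrite inE; apply/srestr_id => v vK.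
    by rewrite ffunE (negbTE vK).
  rewrite card_imset // cardsT card_ord.
  have := card_pffun_on (ord0 : 'I_3) K predT; rewrite cardT size_enum_ord => <-.
  apply: subset_leq_card; apply/subsetP => s; rewrite inE => /srestr_id sK.
  apply/pffun_onP; split=> //; apply/supportP => v; exact: sK.
transitivity (\sum_(s in d @: setT) F s); last by rewrite dS; apply: eq_bigl => s; rewrite inE.
by rewrite big_imset /=; [apply: eq_bigl => a; rewrite inE | move=> a a' _ _; apply: d_inj].
Qed.
Definition update_step (i a : nat) (m : memory) : memory :=
  upd m (den [:: i; a] m (taddress (Var 0) (Var 1)))
    (den [:: i; a] m (tupdate (Var 0) (Var 1))).

Definition message_step (i : nat) (m : memory) : memory :=
  steps (update_step i) m (den [:: i] m (tstates (Var 0))).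

Section MessagePhase.
Variables (n N : nat) (G : rel 'I_n) (T : rel 'I_N) (B : 'I_N -> {set 'I_n}) (t : nat).
Variables (m1 : memory) (xs : nat -> 'I_N).
Hypothesis G_simple : simple_graph G.
Hypothesis T_decomposition : tree_decomposition G T B.
Hypothesis m1_input : holds_input G T B t m1.
Hypothesis m1_xs : forall j, j < N -> m1 (input_base n N + j) = xs j.
Hypothesis m1_0 : forall a, input_base n N + N <= a -> m1 a = 0.
Hypothesis xs_inj : forall j k, j < N -> k < N -> xs j = xs k -> j = k.
Hypothesis xs_adj : forall k, 0 < k < N -> exists2 j, j < k & T (xs j) (xs k).

Let b k := B (xs k).
Let x := 2 ^ (n.+1 * n.+1).
Let loc := local b G (vertex_weight x) edge_weight.

(** The input and the node order; the cells behind them belong to the messages. *)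
Definition same_prefix (m : memory) : Prop :=
  forall a, a < input_base n N + N -> m a = m1 a.

Lemma same_prefix_input m : same_prefix m -> holds_input G T B t m.
Proof. by move=> mm a ab; rewrite mm ?m1_input // ltn_addr. Qed.

Lemma same_prefix_xs m : same_prefix m -> forall j, j < N -> m (input_base n N + j) = xs j.
Proof. by move=> mm j jN; rewrite mm ?m1_xs // ltn_add2l. Qed.

Lemma cell_inj k k' c c' : k < N -> k' < N -> cell n N k c = cell n N k' c' -> k = k' /\ c = c'.
Proof.
move=> kN kN' /addnI E; have := congr1 (modn^~ N) E; have := congr1 (divn^~ N) E.
by rewrite /= !modnMDl !modn_small // !divnMDl ?(leq_ltn_trans _ kN) // !divn_small // !addn0.
Qed.

Lemma cell_surj a : 0 < N -> input_base n N + N <= a -> exists k c, k < N /\ a = cell n N k c.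
Proof.
move=> N0 ab; exists ((a - (input_base n N + N)) %% N), ((a - (input_base n N + N)) %/ N).
by rewrite ltn_mod N0 /cell -divn_eq subnKC.
Qed.

Lemma cell_ge k c : input_base n N + N <= cell n N k c.
Proof. exact: leq_addr. Qed.

Definition addend (m : memory) (i a : nat) : nat := summand G T B m xs (N - 1 - i) a.
Definition target (i a : nat) : nat := address B xs (N - 1 - i) a.

Lemma update_stepE m i a : same_prefix m -> i < N ->
  update_step i a m = upd m (target i a) (m (target i a) + addend m i a).
Proof.
move=> mm iN; rewrite /update_step.
have mi := same_prefix_input mm; have mx := same_prefix_xs mm.
rewrite (@den_address _ _ _ _ _ _ _ _ mi mx [:: i; a] _ _ i a) //.
by rewrite (@den_update _ _ _ _ _ _ _ _ mi mx [:: i; a] _ _ i a).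
Qed.

Lemma summand_eq m m' k a :
  (forall j c, k < j < N -> m (cell n N j c) = m' (cell n N j c)) ->
  summand G T B m xs k a = summand G T B m' xs k a.
Proof.
move=> mm; congr (_ * _); apply: eq_bigr => j _.
by case: ifP => // /andP[ij _]; rewrite mm // ij ltn_ord.
Qed.

(** An update reads factors only from cells of later nodes and writes only to cells of its own node,
    so earlier updates do not change the addend of later ones. *)
Lemma update_steps m i A : same_prefix m -> i < N ->
  forall z, steps (update_step i) m A z
  = m z + \sum_(a < A) (z == target i a) * addend m i a.
Proof.
move=> mm iN; elim: A => [|A IH] z; first by rewrite big_ord0 addn0.
set s := steps (update_step i) m A in IH.
have sm a : a < input_base n N + N -> s a = m a.
  move=> ab; rewrite IH big1 ?addn0 // => a' _; rewrite (_ : (a == _) = false) //.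
  by apply/eqP => E;
    have := cell_ge (N - 1 - i) (code (srestr (upto b (N - 1 - i)) (decode (b (N - 1 - i)) a'))); rewrite leqNgt -[cell _ _ _ _]/(target i a') -E ab.
have ss : same_prefix s by move=> a ab; rewrite sm ?mm.
have sa : addend s i A = addend m i A.
  apply: summand_eq => j c /andP[ij jN]; rewrite IH big1 ?addn0 // => a' _.
  rewrite (_ : (_ == _) = false) //; apply/eqP => /cell_inj[] //; first by lia.
  by move=> E; rewrite E ltnn in ij.
rewrite [LHS]/= -/s (update_stepE A ss iN) sa big_ord_recr /= /upd !IH.
by case: eqP => [->|_]; rewrite ?mul1n ?mul0n ?addn0 ?addnA.
Qed.

Lemma update_steps_prefix m i A : same_prefix m -> i < N ->
  same_prefix (steps (update_step i) m A).
Proof.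
move=> mm iN a ab; rewrite update_steps // mm // big1 ?addn0 // => a' _.
rewrite (_ : (a == _) = false) //; apply/eqP => E.
by move: ab; rewrite E ltnNge /target /address leq_addr.
Qed.

Definition message_mem (i : nat) : memory := steps message_step m1 i.

Lemma message_memS i z : same_prefix (message_mem i) -> i < N ->
  message_mem i.+1 z = message_mem i z
    + \sum_(a < 3 ^ #|b (N - 1 - i)|) (z == target i a) * addend (message_mem i) i a.
Proof.
move=> mm iN; rewrite /message_mem [LHS]/= /message_step -/(message_mem i).
rewrite (@den_states _ _ _ _ _ _ _ _ (same_prefix_input mm) (same_prefix_xs mm) _ _ i) //.
exact: update_steps.
Qed.

Lemma message_mem_prefix i : i <= N -> same_prefix (message_mem i).
Proof.
elim: i => [|i IH] iN //; have mm := IH (ltnW iN).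
move=> a ab; rewrite message_memS // mm // big1 ?addn0 // => a' _.
rewrite (_ : (a == _) = false) //; apply/eqP => E.
by move: ab; rewrite E ltnNge /target /address leq_addr.
Qed.

Lemma message_mem_cell i j c : i < N -> j < N -> j != N - 1 - i ->
  message_mem i.+1 (cell n N j c) = message_mem i (cell n N j c).
Proof.
move=> iN jN ji; rewrite message_memS //; last exact/message_mem_prefix/ltnW.
rewrite big1 ?addn0 // => a' _; rewrite (_ : (_ == _) = false) //.
apply/eqP => /cell_inj[] //; first by lia.
by move=> E; rewrite E eqxx in ji.
Qed.
Lemma message_mem_step i : i < N -> forall z, message_mem i z <= message_mem i.+1 z.
Proof. by move=> iN z; rewrite message_memS ?leq_addr //; apply/message_mem_prefix/ltnW. Qed.

Lemma message_mem_mono i z : i <= N -> message_mem i z <= message_mem N z.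
Proof.
move=> iN; rewrite -(subnKC iN); have : i + (N - i) <= N by rewrite subnKC.
elim: (N - i) => [|d IH] dN; first by rewrite addn0.
by rewrite addnS in dN *; apply: leq_trans (IH (ltnW dN)) (message_mem_step dN z).
Qed.

(** Transfers size bounds on the final messages to every memory met during the run. *)
Lemma update_steps_mono i A z : i < N -> A <= 3 ^ #|b (N - 1 - i)| ->
  steps (update_step i) (message_mem i) A z <= message_mem N z.
Proof.
move=> iN Ab; apply: leq_trans (message_mem_mono z iN).
have mm := message_mem_prefix (ltnW iN); rewrite update_steps // message_memS // leq_add2l.
rewrite (big_ord_widen _ (fun a => (z == target i a) * addend (message_mem i) i a) Ab).
by rewrite big_mkcond; apply: leq_sum => a _; case: ifP.
Qed.

(** When a node is processed its own cells are still 0 and those of later nodes are final, so the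
    recursion, once established, survives the remaining rounds. *)
Lemma message_mem_rec i : i <= N ->
  (forall j c, j < N - i -> message_mem i (cell n N j c) = 0) /\
  (forall k c, N - i <= k < N -> message_mem i (cell n N k c) =
    \sum_(a < 3 ^ #|b k|) (c == code (srestr (upto b k) (decode (b k) a)))
      * summand G T B (message_mem i) xs k a).
Proof.
elim: i => [|i IH] iN.
  split=> [j c _|k c]; first by rewrite /message_mem /= m1_0 ?cell_ge.
  by rewrite subn0 ltnNge andbN.
have [Z R] := IH (ltnW iN); have mm := message_mem_prefix (ltnW iN).
split=> [j c ji|k c /andP[ik kN]]; first by rewrite message_mem_cell ?Z //; lia.
have S a : summand G T B (message_mem i.+1) xs k a = summand G T B (message_mem i) xs k a.
  by apply: summand_eq => j c' /andP[kj jN]; rewrite message_mem_cell //; lia.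
under eq_bigr => a _ do rewrite S.
have [kE|kne] := eqVneq k (N - 1 - i); last first.
  by rewrite message_mem_cell // R //; lia.
rewrite message_memS // Z; last by lia.
rewrite add0n -kE; apply: eq_bigr => a _; congr (_ * _); last by rewrite /addend -kE.
rewrite /target -kE; congr nat_of_bool; apply/eqP/eqP => [/cell_inj[]//|->//].
Qed.

Let M k (r : spins n) := message_mem N (cell n N k (code r)).
Let par := parent T xs.

Let T_tree : tree T := T_decomposition.1.
Let T_forest : forest T. Proof. by case: T_tree. Qed.
Let N_gt0 : 0 < N. Proof. by case: T_tree; rewrite card_ord. Qed.

Let par_lt k : 0 < k < N -> par k < k.
Proof. by move=> kN; have [] := parentP xs_adj kN. Qed.

Let B_rip k i v : i < k -> k < N -> v \in b k -> v \in b i -> v \in b (par k).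
Proof.
have [_ [_ _ Bc]] := T_decomposition.
exact: (running_intersection T_forest xs_inj xs_adj Bc).
Qed.

Let B_vertex v : exists2 k, k < N & v \in b k.
Proof.
have [_ [Bv _ _]] := T_decomposition; have [y vy] := Bv v.
by have [k kN ky] := order_surj xs_inj y; exists k; rewrite // /b ky.
Qed.

Let B_edge u v : G u v -> exists2 k, k < N & (u \in b k) && (v \in b k).
Proof.
have [_ [_ Be _]] := T_decomposition; move=> /Be[y uvy].
by have [k kN ky] := order_surj xs_inj y; exists k; rewrite // /b ky.
Qed.

Lemma message_rec k r : k < N -> M k r =
  \sum_(s | (srestr (b k) s == s) && (srestr (upto b k) s == r))
     loc k s * \prod_(j < N | (k < j) && (par j == k)) M j (srestr (b j) s).
Proof.
move=> kN; have [_ R] := message_mem_rec (leqnn N).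
rewrite /M R ?subnn ?leq0n //.
pose F s := (r == srestr (upto b k) s)
   * (loc k s * \prod_(j < N | (k < j) && (par j == k)) M j (srestr (b j) s)).
transitivity (\sum_(a < 3 ^ #|b k|) F (decode (b k) a)).
  apply: eq_bigr => a _; congr (_ * (_ * _)).
    by rewrite (inj_eq (@code_inj n)).
  rewrite [RHS]big_mkcond; apply: eq_bigr => j _.
  (* The program recognises a child as an adjacent later node; uniqueness of the earlier neighbour
     turns this into [par j == k]. *)
  case: ltnP => //= kj; rewrite (parent_unique T_forest xs_inj xs_adj) //.
rewrite sum_decode big_mkcondr; apply: eq_bigr => s _.
by rewrite /F eq_sym; case: eqP => _; rewrite ?mul1n ?mul0n.
Qed.

(** No bag precedes the root, so its message is for the all-zero assignment, whose code is 0. *)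
Lemma root_message : message_mem N (cell n N 0 0) = \sum_s weight G (vertex_weight x) edge_weight s.
Proof.
have c0 : code ([ffun=> ord0] : spins n) = 0 by rewrite /code big1 // => v _; rewrite ffunE.
rewrite -[X in cell n N 0 X]c0 -[LHS]/(M 0 [ffun=> ord0]).
rewrite (elimination par_lt B_rip (@local_srestr _ b G _ _) message_rec N_gt0 (upto_cover B_vertex)).
apply: eq_bigr => s _.
exact: (prod_local (vertex_weight x) edge_weight par_lt B_rip B_vertex B_edge s).
Qed.

Lemma message_mem_result : 0 < t ->
  (message_mem N (cell n N 0 0) %/ 2 ^ n %/ x ^ t) %% 2 = #|fvs_of_size G t| %% 2.
Proof.
move=> t0; rewrite root_message; apply: count_modulo => //.
  by rewrite /x mulSn addSn expnS dvdn_mulr.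
by rewrite /x ltn_exp2l //; lia.
Qed.

Lemma message_mem_bound i z : i <= N -> input_base n N + N <= z ->
  message_mem i z <= (3 ^ n * ((2 * x) ^ n * 2 ^ (n * n))) ^ N.
Proof.
move=> iN zb; apply: leq_trans (message_mem_mono z iN) _.
have [k [c [kN ->]]] := cell_surj N_gt0 zb.
have [_ R] := message_mem_rec (leqnn N).
(* Addresses are sparse: a cell whose index codes no assignment receives nothing and stays 0. *)
have [[s cs]|nc] := pselect (exists s : spins n, c = code s).
  rewrite cs; apply: (message_bound par_lt message_rec _ _ s kN).
    by rewrite !muln_gt0 !expn_gt0 muln_gt0 expn_gt0.
  apply: local_bound => [|y|y y'].
  - by rewrite muln_gt0 expn_gt0.
  - by rewrite /vertex_weight; case: ifP => //; rewrite muln_gt0 expn_gt0.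
  - by rewrite /edge_weight; case: ifP => //; case: ifP.
rewrite R ?subnn ?leq0n // big1 // => a _; case: eqP => // cE.
by case: nc; eexists; exact: cE.
Qed.

End MessagePhase.

(** * Execution and cost *)

Definition put (vs : seq nat) (o : nat) (a v : tm) : cmd :=
  Seq (compile vs o a) (Seq (compile vs o.+1 v) (Store (Reg o) (Reg o.+1))).

Definition for_loop (vs : seq nat) (o : nat) (c : tm) (body : cmd) : cmd :=
  Seq (compile vs o c) (loop o body).

Lemma put_correct sm vs o a v : wt sm a -> wt sm v -> size vs = size sm ->
  all (fun i => i < o) vs ->
  exists e, forall L s, 1 < L -> env_ok L sm (map (regs s) vs) -> mem_ok L (Defs.mem s) ->
  exists s' k, [/\ exec (put vs o a v) s s' k,
    Defs.mem s' = upd (Defs.mem s) (den (map (regs s) vs) (Defs.mem s) a)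
      (den (map (regs s) vs) (Defs.mem s) v),
    forall j, j < o -> regs s' j = regs s j & k <= L ^ e].
Proof.
move=> wa wv sz vo.
have vo' : all (fun v => v < o.+1) vs by apply: sub_all vo => i; apply: ltnW.
have [ea Ha] := comp_correct wa sz vo; have [ev Hv] := comp_correct wv sz vo'.
have [da Da] := den_bound wa; have [dv Dv] := den_bound wv.
have [e He] : poly_bounded (fun L => L ^ ea + (L ^ ev + (1 + (bitlen o + L ^ da) + (bitlen o.+1 + L ^ dv) + L ^ da + L ^ dv))) by poly_tac.
exists e => L s L1 er mr; set r := map (regs s) vs in er *.
have sr : size r = size sm by rewrite size_map.
have [A _] := Da L r _ L1 sr er mr; have [V _] := Dv L r _ L1 sr er mr.
have [s1 [k1 [x1 m1 r1 p1 q1]]] := Ha L s L1 er mr.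
have rE : map (regs s1) vs = r by apply: map_regs_eq p1.
have er1 : env_ok L sm (map (regs s1) vs) by rewrite rE.
have mr1 : mem_ok L (Defs.mem s1) by rewrite m1.
have [s2 [k2 [x2 m2 r2 p2 q2]]] := Hv L s1 L1 er1 mr1.
rewrite rE m1 in r2; have r1' : regs s2 o = den r (Defs.mem s) a by rewrite p2.
eexists; eexists; split; first exact: exec_seq x1 (exec_seq x2 (exec_store _ _ _)).
- by rewrite /= r1' r2 m2 m1.
- by move=> j jo; rewrite /= p2 ?p1 // ltnW.
- by apply: leq_trans (He _ L1); rewrite /= r1' r2; lia.
Qed.

(** The number of iterations may be exponential here, so it appears as an explicit factor, and only
    its bit length is absorbed into [L ^ e]. *)
Lemma for_loop_correct sm vs o c body : wt sm c -> size vs = size sm ->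
  all (fun i => i < o) vs ->
  exists e, forall L K s (mu : nat -> memory) cnt, 1 < L ->
  env_ok L sm (map (regs s) vs) -> mem_ok L (Defs.mem s) -> mu 0 = Defs.mem s ->
  den (map (regs s) vs) (Defs.mem s) c = cnt ->
  (forall i s1, i < cnt -> Defs.mem s1 = mu i ->
     map (regs s1) (rcons vs o.+1) = rcons (map (regs s) vs) i ->
     exists s2 k, [/\ exec body s1 s2 k, Defs.mem s2 = mu i.+1,
       forall j, j < o.+2 -> regs s2 j = regs s1 j & k <= K]) ->
  exists s' k, [/\ exec (for_loop vs o c body) s s' k, Defs.mem s' = mu cnt,
    forall j, j < o -> regs s' j = regs s j & k <= L ^ e + cnt.+1 * (K + L ^ e)].
Proof.
move=> wc sz vo; have [ec Hc] := comp_correct wc sz vo; have [d D] := den_bound wc.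
have [e He] : poly_bounded (fun L => L ^ ec + 20 * (bitlen o.+1 + L ^ d)) by poly_tac.
exists e => L K s mu cnt L1 er mr mu0 cntE Hbody; set r := map (regs s) vs in er cntE Hbody *.
have sr : size r = size sm by rewrite size_map.
have [C _] := D L r _ L1 sr er mr; rewrite cntE in C.
have [s1 [k1 [x1 m1 r1 p1 q1]]] := Hc L s L1 er mr.
pose I i s' := Defs.mem s' = mu i /\ forall j, j < o -> regs s' j = regs s j.
have : exists s2 k2, [/\ exec (loop o body) s1 s2 k2, I cnt s2 &
    k2 <= cnt.+1 * (K + 20 * (bitlen o.+1 + bitlen cnt))].
  apply: exec_loop.
  - move=> i v s' [I1 I2]; split=> // j jo.
    by rewrite /= upd_neq ?I2 // neq_ltn ltnW.
  - move=> i s' ic so si [I1 I2].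
    have rE : map (regs s') (rcons vs o.+1) = rcons r i.
      by rewrite map_rcons si (map_regs_eq vo I2).
    have [s2 [k [x2 m2 p2 q2]]] := Hbody i s' ic I1 rE.
    exists s2, k; split=> //; rewrite ?p2 //.
    by split=> // j jo; rewrite p2 ?I2 // (ltn_trans jo) // ltnW.
  - by rewrite r1.
  - by split=> //; rewrite m1.
move=> [s2 [k2 [x2 [m2 p2] q2]]]; exists s2, (k1 + k2); split=> //; first exact: exec_seq x1 x2.
have := He _ L1 => HL; apply: leq_add.
  by apply: leq_trans q1 _; apply: leq_trans HL; apply: leq_addr.
apply: leq_trans q2 _; rewrite leq_mul2l leq_add2l /=; apply: leq_trans HL.
by apply: leq_trans (leq_addl _ _); rewrite leq_mul2l leq_add2l.
Qed.

(** Registers 0 and 1 hold bound and index of the loop over nodes, registers 2 and 3 those of the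
    loop over spin assignments. *)
Definition order_body : cmd := put [:: 1] 2 (Plus tbase (Var 0)) (tnext (Var 0)).
Definition message_body : cmd :=
  put [:: 1; 3] 4 (taddress (Var 0) (Var 1)) (tupdate (Var 0) (Var 1)).

(** If the guard fails, register 0 keeps the value 0, the right answer since no set has t > n
    elements. *)
Definition program : cmd :=
  Seq (compile [::] 0 tguard)
    (If (Reg 0)
      (Seq (for_loop [::] 0 tN order_body)
        (Seq (for_loop [::] 0 tN (for_loop [:: 1] 2 (tstates (Var 0)) message_body))
          (compile [::] 0 tresult)))
      Skip).

Lemma message_bitlen n N z :
  z <= (3 ^ n * ((2 * 2 ^ (n.+1 * n.+1)) ^ n * 2 ^ (n * n))) ^ N ->
  bitlen z <= (N * (2 * n + ((n.+1 * n.+1).+1 * n + n * n))).+1.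
Proof.
move=> zB; set e := N * _; have expW a b c : a <= b -> a ^ c <= b ^ c.
  by case: c => // c ab; rewrite leq_exp2r.
suff ze : z <= 2 ^ e by rewrite bitlenP // (leq_ltn_trans ze) // ltn_exp2l.
apply: leq_trans zB _; rewrite /e (mulnC N) [X in _ <= X]expnM; apply: (expW).
rewrite -expnS -expnM -expnD [X in _ <= X]expnD leq_mul2r; apply/orP; right.
rewrite expnM; exact: expW.
Qed.

(** [P] stands for 3^width, and [3 * P] bounds the assignments of a bag of width + 1 elements. [M]
    bounds each compiled piece; the extra [L] comes from the loop over nodes. *)
Lemma total_cost L M P N e1 e2 e3 e4 e5 e6 e7 : 1 < L -> 0 < M -> 0 < P -> N < L ->
  e1 <= M -> e2 <= M -> e3 <= M -> e4 <= M -> e5 <= M -> e6 <= M -> e7 <= M ->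
  e1 + (3 + (e3 + N.+1 * (e2 + e3)
    + (e6 + N.+1 * (e5 + (3 * P).+1 * (e4 + e5) + e6) + e7))) <= 20 * P * (L * M).
Proof.
move=> L1 M0 P0 NL h1 h2 h3 h4 h5 h6 h7.
have PM : M <= P * M by rewrite leq_pmull.
have inner : (3 * P).+1 * (e4 + e5) <= 4 * P * (2 * M) by apply: leq_mul; lia.
have outer : N.+1 * (e5 + (3 * P).+1 * (e4 + e5) + e6) <= L * (10 * (P * M)).
  by apply: leq_mul => //; lia.
have order : N.+1 * (e2 + e3) <= L * (2 * (P * M)) by apply: leq_mul => //; lia.
have LPM : 2 * (P * M) <= L * (P * M) by rewrite leq_mul2r L1 orbT.
have -> : 20 * P * (L * M) = 20 * (L * (P * M)) by lia.
lia.
Qed.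

(** The condition on [L] makes room for the input values, the node numbers and the bits of the
    messages. All exponents are obtained before the input is introduced, so [E] is uniform. *)
Lemma program_correct : exists E,
  forall n N (G : rel 'I_n) (T : rel 'I_N) (B : 'I_N -> {set 'I_n}) t L,
  simple_graph G -> tree_decomposition G T B -> 0 < t ->
  n + N + 4 + N * (2 * n + ((n.+1 * n.+1).+1 * n + n * n)) <= L ->
  computes_within program (encode G T B t) (#|fvs_of_size G t| %% 2)
    (20 * 3 ^ width B * L ^ E).
Proof.
have [e1 guard_ok] := @comp_correct tguard [::] [::] 0 isT erefl isT.
have [e2 order_put] :=
  @put_correct [:: true] [:: 1] 2 _ (tnext (Var 0)) (isT : wt [:: true] (Plus tbase (Var 0))) isT erefl isT.
have [e3 order_for] := @for_loop_correct [::] [::] 0 tN order_body isT erefl isT.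
have [e4 message_put] := @put_correct [:: true; false] [:: 1;
  3] 4 _ (tupdate (Var 0) (Var 1)) (isT : wt [:: true;
    false] (taddress (Var 0) (Var 1))) isT erefl isT.
have [e5 message_for] :=
  @for_loop_correct [:: true] [:: 1] 2 (tstates (Var 0)) message_body isT erefl isT.
have [e6 node_for] :=
  @for_loop_correct [::] [::] 0 tN (for_loop [:: 1] 2 (tstates (Var 0)) message_body) isT erefl isT.
have [e7 result_ok] := @comp_correct tresult [::] [::] 0 isT erefl isT.
pose E := e1 + e2 + e3 + e4 + e5 + e6 + e7; exists E.+1.
move=> n N G T B t L Gs Td t0 HL.
have N0 : 0 < N by case: Td => -[]; rewrite card_ord.
have L1 : 1 < L by lia.
pose m0 : memory := nth 0 (encode G T B t).
have in0 : holds_input G T B t m0 by [].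
have tree_ok : tree T by case: Td.
have mem_ok_input m : holds_input G T B t m -> (forall a, bitlen (m a) <= L) -> mem_ok L m.
  by move=> mi mL; split; rewrite // ?(mem_n mi) ?(mem_N mi); lia.
have bL a : a <= n + N + 2 -> bitlen a <= L.
  by move=> /bitlen_le aL; have := bitlen_leS (n + N + 2); lia.
have m0_ok : mem_ok L m0.
  by apply: mem_ok_input in0 _ => a; apply/bL/encode_bound.
have env0 : env_ok L [::] [::] by move=> i; rewrite !nth_nil; split=> //; apply: bL.
have le e : e <= E -> L ^ e <= L ^ E by move=> eE; rewrite leq_pexp2l // ltnW.
have M_gt0 : 0 < L ^ E by rewrite expn_gt0 ltnW.
have P_gt0 : 0 < 3 ^ width B by rewrite expn_gt0.
have le1 : L ^ e1 <= L ^ E by apply: le; rewrite /E; lia.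
have le2 : L ^ e2 <= L ^ E by apply: le; rewrite /E; lia.
have le3 : L ^ e3 <= L ^ E by apply: le; rewrite /E; lia.
have le4 : L ^ e4 <= L ^ E by apply: le; rewrite /E; lia.
have le5 : L ^ e5 <= L ^ E by apply: le; rewrite /E; lia.
have le6 : L ^ e6 <= L ^ E by apply: le; rewrite /E; lia.
have le7 : L ^ e7 <= L ^ E by apply: le; rewrite /E; lia.
have [s1 [k1 [x1 M1 r1 _ q1]]] := guard_ok L (init (encode G T B t)) L1 env0 m0_ok.
rewrite -[Defs.mem (init _)]/m0 in M1 r1; rewrite [map _ _]/= (den_guard in0) in r1.
case: (leqP t n) r1 => [le_tn|lt_nt] r1; last first.
  exists s1, (k1 + (1 + ecost s1 (Reg 0) + 1)); split.
  - apply: exec_seq x1 _; apply: exec_if; rewrite /= r1 /=; exact: exec_skip.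
  - rewrite r1 (_ : fvs_of_size G t = set0) ?cards0 //.
    apply/setP => X; rewrite !inE; apply/negbTE/negP => /andP[_ /eqP Xt].
    by have := max_card (mem X); rewrite card_ord Xt leqNgt lt_nt.
  - have b0 : bitlen 0 = 1 by [].
    rewrite /= r1 b0 expnS; apply: leq_trans (_ : L ^ e1 + 4 <= _); first by lia.
    have : 1 * (2 * 1) <= 3 ^ width B * (L * L ^ E) by do 2 apply: leq_mul => //.
    have : L ^ e1 <= 3 ^ width B * (L * L ^ E).
      by rewrite mulnA (leq_trans le1) // leq_pmull // muln_gt0 P_gt0 ltnW.
    rewrite -mulnA; lia.
have [xs [memE xs_inj xs_adj]] := order_phase in0 tree_ok.
pose mu1 := steps order_step m0.
have mu1_input k : k <= N -> holds_input G T B t (mu1 k).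
  by move=> kN a ab; rewrite /mu1 memE // leqNgt ab.
have mu1_ok k : k <= N -> mem_ok L (mu1 k).
  move=> kN; apply: mem_ok_input (mu1_input k kN) _ => a; apply: bL; rewrite /mu1 memE //.
  by case: ifP => _; [have := ltn_ord (xs (a - input_base n N)); lia | apply: encode_bound].
have env1 i : i < N -> env_ok L [:: true] [:: i].
  move=> iN [|j] /=; last by rewrite !nth_nil; split=> //; apply: bL.
  by split; [apply: bL|]; lia.
have order_body_ok i s : i < N -> Defs.mem s = mu1 i -> map (regs s) [:: 1] = [:: i] ->
    exists s' k, [/\ exec order_body s s' k, Defs.mem s' = mu1 i.+1,
      forall j, j < 2 -> regs s' j = regs s j & k <= L ^ e2].
  move=> iN sm sr; have := order_put L s L1;
    rewrite sr sm => /(_ (env1 i iN) (mu1_ok i (ltnW iN))).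
  by case=> s' [k [X1 X2 X3 X4]]; exists s', k; split.
have [s2 [k2 [x2 M2 _ q2]]] : exists s2 k2, [/\ exec (for_loop [::] 0 tN order_body) s1 s2 k2,
    Defs.mem s2 = mu1 N, forall j, j < 0 -> regs s2 j = regs s1 j &
    k2 <= L ^ e3 + N.+1 * (L ^ e2 + L ^ e3)].
  apply: (order_for L (L ^ e2) s1 mu1 N L1 env0) => //; first by rewrite M1.
  by rewrite M1 (den_N _ in0).
pose m1 := mu1 N; pose b k := B (xs k).
have m1_input : holds_input G T B t m1 by apply: mu1_input.
have m1_xs j : j < N -> m1 (input_base n N + j) = xs j.
  by move=> jN; rewrite /m1 /mu1 memE // leq_addr ltn_add2l jN addKn.
(* This needs [t <= n]: the encoding then ends before [input_base], and messages start from 0. *)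
have m1_0 a : input_base n N + N <= a -> m1 a = 0.
  move=> ab; rewrite /m1 /mu1 memE // ifN; last by rewrite negb_and -leqNgt ab orbT.
  rewrite /m0 nth_default // size_encode.
  by have := bitlen_leS t; move: ab; rewrite /input_base; lia.
set mu2 := message_mem m1.
have prefix i : i <= N -> same_prefix n N m1 (mu2 i).
  exact: (message_mem_prefix m1_input m1_xs).
have prefix_ok m : same_prefix n N m1 m -> (forall a, input_base n N + N <= a ->
    m a <= mu2 N a) -> mem_ok L m.
  move=> pm bm; apply: mem_ok_input; first exact: (same_prefix_input m1_input pm).
  move=> a; case: (ltnP a (input_base n N + N)) => aB.
    by rewrite pm //; have [] := mu1_ok N (leqnn N).
  apply: leq_trans (bitlen_le (bm a aB)) _.
  have := message_bitlen (message_mem_bound Td m1_input m1_xs m1_0 xs_inj xs_adj (leqnn N) aB).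
  move=> H; apply: leq_trans H (leq_trans _ HL).
  by move: (N * _) => X; lia.
have mu2_mono i a : i <= N -> mu2 i a <= mu2 N a.
  by move=> iN; apply: (message_mem_mono m1_input m1_xs).
have mu2_ok i : i <= N -> mem_ok L (mu2 i).
  by move=> iN; apply: prefix_ok => [|a _]; [apply: prefix | apply: mu2_mono].
have states i : i < N -> den [:: i] (mu2 i) (tstates (Var 0)) = 3 ^ #|b (N - 1 - i)|.
  move=> iN; have pi := prefix i (ltnW iN).
  by rewrite (den_states (same_prefix_input m1_input pi) (same_prefix_xs m1_xs pi) iN).
have bag_width k : #|b k| <= (width B).+1.
  apply: leq_trans (leqSpred _); exact: (leq_bigmax (F := fun y => #|B y|)).
(* The number of an assignment is not small, but below 3^n and hence of at most 2n + 1 bits. *)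
have env2 i a : i < N -> a < 3 ^ #|b (N - 1 - i)| -> env_ok L [:: true; false] [:: i; a].
  move=> iN aB [|[|j]] /=; last by rewrite !nth_nil; split=> //; apply: bL.
    by split; [apply: bL|]; lia.
  split=> //; have a3 : a <= 3 ^ n.
    apply: leq_trans (ltnW aB) _; rewrite leq_pexp2l //.
    by rewrite (leq_trans (max_card _)) ?card_ord.
  have := bitlen_le a3; have a4 : 3 ^ n < 2 ^ (2 * n).+1.
    rewrite expnS expnM; have : 3 ^ n <= (2 ^ 2) ^ n.
      by case: (n) => // n'; rewrite leq_exp2r.
    have : 0 < (2 ^ 2) ^ n by rewrite expn_gt0.
    by move: (3 ^ n) ((2 ^ 2) ^ n); lia.
  rewrite -bitlenP // in a4.
  have : 2 * n <= N * (2 * n) by rewrite leq_pmull.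
  by rewrite mulnDr in HL; lia.
pose K := L ^ e5 + (3 ^ (width B).+1).+1 * (L ^ e4 + L ^ e5).
have node_body_ok i s : i < N -> Defs.mem s = mu2 i -> map (regs s) [:: 1] = [:: i] ->
    exists s' k, [/\ exec (for_loop [:: 1] 2 (tstates (Var 0)) message_body) s s' k,
      Defs.mem s' = mu2 i.+1, forall j, j < 2 -> regs s' j = regs s j & k <= K].
  move=> iN sm sr; have pi := prefix i (ltnW iN).
  pose nu := steps (update_step i) (mu2 i).
  have nu_ok A : A <= 3 ^ #|b (N - 1 - i)| -> mem_ok L (nu A).
    move=> AB; apply: prefix_ok; first exact: (update_steps_prefix m1_input m1_xs).
    by move=> a _; apply: (update_steps_mono m1_input m1_xs).
  have inner a s' : a < 3 ^ #|b (N - 1 - i)| -> Defs.mem s' = nu a ->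
      map (regs s') [:: 1; 3] = [:: i; a] ->
      exists s2 k, [/\ exec message_body s' s2 k, Defs.mem s2 = nu a.+1,
        forall j, j < 4 -> regs s2 j = regs s' j & k <= L ^ e4].
    move=> aB sm' sr'; have := message_put L s' L1.
    rewrite sr' sm' => /(_ (env2 i a iN aB) (nu_ok a (ltnW aB))).
    by case=> s4 [k4 [X1 X2 X3 X4]]; exists s4, k4; split.
  have := message_for L (L ^ e4) s nu (3 ^ #|b (N - 1 - i)|) L1.
  rewrite sr sm => /(_ (env1 i iN) (mu2_ok i (ltnW iN)) erefl (states i iN) inner).
  case=> s3 [k3 [X1 X2 X3 X4]]; exists s3, k3; split=> //.
    by rewrite X2 /nu -(states i iN).
  apply: leq_trans X4 _; rewrite leq_add2l leq_mul2r ltnS leq_pexp2l ?orbT //.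
have [s3 [k3 [x3 M3 _ q3]]] : exists s3 k3, [/\
    exec (for_loop [::] 0 tN (for_loop [:: 1] 2 (tstates (Var 0)) message_body)) s2 s3 k3,
    Defs.mem s3 = mu2 N, forall j, j < 0 -> regs s3 j = regs s2 j &
    k3 <= L ^ e6 + N.+1 * (K + L ^ e6)].
  apply: (node_for L K s2 mu2 N L1 env0) => //; first by rewrite M2; apply: mu1_ok.
  by rewrite M2 (den_N _ m1_input).
have pN := prefix N (leqnn N).
have [s4 [k4 [x4 _ r4 _ q4]]] : exists s4 k4, [/\ exec (compile [::] 0 tresult) s3 s4 k4,
    Defs.mem s4 = Defs.mem s3, regs s4 0 = den [::] (mu2 N) tresult,
    forall j, j < 0 -> regs s4 j = regs s3 j & k4 <= L ^ e7].
  by have := result_ok L s3 L1 env0; rewrite M3 => /(_ (mu2_ok N (leqnn N))).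
exists s4, (k1 + (1 + ecost s1 (Reg 0) + (k2 + (k3 + k4)))); split.
- apply: exec_seq x1 _; apply: exec_if; rewrite /= r1 /=.
  exact: exec_seq x2 (exec_seq x3 x4).
- rewrite r4 (den_result (same_prefix_input m1_input pN)) //.
  exact: (message_mem_result Gs Td m1_input m1_xs m1_0 xs_inj xs_adj t0).
- have b0 : bitlen 0 = 1 by []. have b1 : bitlen 1 = 1 by [].
  have NL : N < L by lia.
  rewrite /= r1 b0 b1 expnS.
  apply: leq_trans (total_cost L1 M_gt0 P_gt0 NL le1 le2 le3 le4 le5 le6 le7).
  by move: q2 q3; rewrite /K expnS; lia.
Qed.

(* A tree decomposition of an n-vertex graph may have any number N of nodes, all
   of which are part of the input; maxn n N is n for decompositions with at most
   n nodes, and at most polynomial in n whenever N is. *)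
Theorem theorem4 :
  exists (P : cmd) (C c : nat),
    forall (n N : nat) (G : rel 'I_n) (T : rel 'I_N) (B : 'I_N -> {set 'I_n})
           (tw t : nat),
      simple_graph G ->
      tree_decomposition G T B ->
      width B = tw ->
      0 < t ->
      computes_within P (encode G T B t) (#|fvs_of_size G t| %% 2)
        (C * 3 ^ tw * (maxn n N) ^ c).
Proof.
have [E run] := program_correct; exists program, (20 * 20 ^ E), (4 * E).
move=> n N G T B tw t Gs Td <- t0; set w := maxn n N.
have N0 : 0 < N by case: Td => -[]; rewrite card_ord.
have nw : n <= w := leq_maxl n N; have Nw : N <= w := leq_maxr n N.
have w0 : 0 < w by apply: leq_trans Nw.
(* The run is instantiated with L = 20 w^4, as the bit length of the messages has degree 4 in w;
   this fixes the constants in the witnesses. *)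
have -> : 20 * 20 ^ E * 3 ^ width B * w ^ (4 * E) = 20 * 3 ^ width B * (20 * w ^ 4) ^ E.
  rewrite expnMn -expnM; lia.
apply: run => //.
have pw i j : i <= j -> w ^ i <= w ^ j by apply: leq_pexp2l.
have sq : (n.+1 * n.+1).+1 <= 5 * w ^ 2.
  have : n.+1 * n.+1 <= (2 * w) * (2 * w) by apply: leq_mul; lia.
  have : 0 < w ^ 2 by rewrite expn_gt0 w0.
  rewrite -mulnn; lia.
have cube : (n.+1 * n.+1).+1 * n <= 5 * w ^ 3 by rewrite (expnSr w 2) mulnA leq_mul.
have nn : n * n <= w ^ 3 by apply: leq_trans (pw 2 3 isT); rewrite -mulnn leq_mul.
have n3 : n <= w ^ 3 by apply: leq_trans (pw 1 3 isT); rewrite expn1.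
have quart : N * (2 * n + ((n.+1 * n.+1).+1 * n + n * n)) <= w * (8 * w ^ 3).
  by apply: leq_mul => //; lia.
have w4 : w <= w ^ 4 by rewrite -[X in X <= _]expn1 pw.
by rewrite mulnCA -expnS in quart; lia.
Qed.
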